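(* Let $g\in\mathcal H^\infty(B_{\ell_2},\ell_2)$ with $\|g\|=1$ and $g(B_{\ell_2})\subset B_{\ell_2}$. Suppose that $g$ satisfies: (1) $\|g(0)\|+\|g-g(0)\|\le 1$; (2) there is a linear transformation $P:\ell_2\to\ell_2$ with $\|P\|\le 1$ and non-trivial kernel such that $g=g\circ P$ on $B_{\ell_2}$. Then there exists an analytic injection $$\Psi_g: B_{\mathcal H^\infty(B_{\ell_2},\ell_2)}\to\mathscr F(g),$$ where $B_{\mathcal H^\infty(B_{\ell_2},\ell_2)}$ is the open unit ball of $\mathcal H^\infty(B_{\ell_2},\ell_2)$ and $\mathscr F(g)\subset\mathcal M_{u,\infty}(B_{\ell_2},B_{\ell_2})$ is the fiber over $g$.
   Context: All spaces are complex and $B_{\ell_2}$ is the open unit ball of $\ell_2$. $\mathcal A_u(B_{\ell_2})$ is the Banach algebra (sup norm) of holomorphic functions $f:B_{\ell_2}\to\mathbb C$ that are uniformly continuous on $B_{\ell_2}$. $\mathcal H^\infty(B_{\ell_2})$ is the Banach algebra of bounded holomorphic functions $B_{\ell_2}\to\mathbb C$ with the sup norm; $\mathcal H^\infty(B_{\ell_2},\ell_2)$ is the Banach space of bounded holomorphic maps $B_{\ell_2}\to\ell_2$ with the norm $\|g\|=\sup_{x\in B_{\ell_2}}\|g(x)\|$. In $\|g-g(0)\|$, $g(0)$ is viewed as a constant function; $\|P\|$ is the operator norm. The vector-valued spectrum is $\mathcal M_{u,\infty}(B_{\ell_2},B_{\ell_2})=\{\Phi:\mathcal A_u(B_{\ell_2})\to\mathcal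 H^\infty(B_{\ell_2})\ \text{nonzero algebra homomorphism}\}$. With $(e_n)$ the canonical basis of $\ell_2$, the projection $\xi:\mathcal M_{u,\infty}(B_{\ell_2},B_{\ell_2})\to\mathcal H^\infty(B_{\ell_2},\ell_2)$ is $\xi(\Phi)(x)=\big(\Phi(\langle\cdot,e_n\rangle)(x)\big)_n$. The fiber over $g$ is $\mathscr F(g)=\xi^{-1}(g)$. A map $\Psi:B_{\mathcal H^\infty(B_{\ell_2},\ell_2)}\to\mathcal M_{u,\infty}(B_{\ell_2},B_{\ell_2})$ is called analytic if for every $f\in\mathcal A_u(B_{\ell_2})$ and $x\in B_{\ell_2}$ the function $h\mapsto\Psi(h)(f)(x)$ is holomorphic on $B_{\mathcal H^\infty(B_{\ell_2},\ell_2)}$. An analytic injection is an injective analytic map. *)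

(* Defs.v *)
From HB Require Import structures.
From mathcomp Require Import all_boot all_order all_algebra complex.
From mathcomp Require Import all_classical all_reals all_analysis.
From mathcomp Require Import ring lra.

Set Implicit Arguments.
Unset Strict Implicit.
Unset Printing Implicit Defensive.

Import Order.TTheory GRing.Theory Num.Theory.
Import numFieldNormedType.Exports.

Local Open Scope classical_set_scope.
Local Open Scope ring_scope.
Local Open Scope complex_scope.

(* Norms on complex normed modules take their values in R[i]; rnorm is the same
   number as an element of R, where suprema and series are available. *)
Definition rnorm (R : realType) (V : normedModType R[i]) (x : V) : R :=
  complex.Re `|x|.

Definition uball (R : realType) (V : normedModType R[i]) : set V :=
  [set x | `|x| < 1].
Arguments uball {R V}.

Section norms.
Variable (R : realType).

Lemma rnormE (V : normedModType R[i]) (x : V) : (rnorm x)%:C = `|x|.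
Proof. by rewrite /rnorm RRe_real // ger0_real // normr_ge0. Qed.

Lemma rnorm_ge0 (V : normedModType R[i]) (x : V) : 0 <= rnorm x.
Proof. by rewrite -lecR rnormE normr_ge0. Qed.

Lemma rnormD (V : normedModType R[i]) (x y : V) :
  rnorm (x + y) <= rnorm x + rnorm y.
Proof. by rewrite -lecR raddfD /= !rnormE ler_normD. Qed.

Lemma rnormZ (V : normedModType R[i]) (a : R[i]) (x : V) :
  rnorm (a *: x) = rnorm (a : R[i]^o) * rnorm x.
Proof.
by apply: complexI; rewrite rnormE [RHS]rmorphM /= !rnormE normrZ.
Qed.

Lemma rnorm0_eq0 (V : normedModType R[i]) (x : V) : rnorm x = 0 -> x = 0.
Proof.
move=> x0; apply/eqP; rewrite -normr_eq0 -rnormE x0; exact/eqP.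
Qed.

Lemma rnorm0 (V : normedModType R[i]) : rnorm (0 : V) = 0.
Proof. by rewrite /rnorm normr0. Qed.

Lemma uball0 (V : normedModType R[i]) : uball (0 : V).
Proof. by rewrite /uball /= normr0 ltr01. Qed.

Lemma uball_nbhs (V : normedModType R[i]) (x : V) :
  uball x -> \forall y \near x, uball y.
Proof.
move=> Bx; have e0 : 0 < 1 - `|x| by rewrite subr_gt0.
apply/nbhs_ballP; exists (1 - `|x|) => //= y; rewrite -ball_normE /= => xy.
rewrite /uball /= -(subrK x y) addrC (le_lt_trans (ler_normD _ _)) //.
by rewrite addrC -ltrBrDr distrC.
Qed.

Lemma near_differentiable (V W : normedModType R[i]) (f g : V -> W) (x : V) :
  (\forall y \near x, f y = g y) -> differentiable f x -> differentiable g x.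
Proof.
move=> fg /diff_locallyP [dc df].
have fgx : f x = g x := nbhs_singleton fg.
have dg : g \o shift x = cst (g x) + 'd f x +o_ 0 id.
  apply/eqaddoP => e e0.

  move/eqaddoP: df => /(_ e e0).
  move: fg; rewrite (near_shift 0 x) => fg.
  apply: filterS2 fg => h; rewrite /= subr0 => fgh.
  by rewrite !fctE /= fgh fgx.
have dE : 'd g x = 'd f x :> (V -> W) by apply: diff_unique.
by apply/diff_locallyP; rewrite dE.
Qed.
End norms.

Section sqsum.
Variable (R : realType).
Implicit Types a b c : nat -> R.

Let sq a : nat -> R := series (fun k => a k ^+ 2).

Lemma sqsum_nd a : nondecreasing_seq (sq a).
Proof.
by apply/nondecreasing_seqP => n; rewrite /sq seriesSr lerDl sqr_ge0.
Qed.

Lemma sqsum_ge0 a n : 0 <= sq a n.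
Proof. by rewrite /sq seriesEnat sumr_ge0 // => i _; rewrite sqr_ge0. Qed.

Lemma sqsum_le_lim a n : cvgn (sq a) -> sq a n <= limn (sq a).
Proof. by move=> ca; apply: nondecreasing_cvgn_le => //; exact: sqsum_nd. Qed.

Lemma sqsum_lim_ge0 a : cvgn (sq a) -> 0 <= limn (sq a).
Proof. by move=> ca; exact: le_trans (sqsum_ge0 a 0) (sqsum_le_lim _ ca). Qed.

Lemma sqsum_bounded_cvg a (M : R) : (forall n, sq a n <= M) -> cvgn (sq a).
Proof.
move=> aM; apply: nondecreasing_is_cvgn; first exact: sqsum_nd.
by exists M => _ [n _ <-]; exact: aM.
Qed.

Lemma sqsum_term a k : cvgn (sq a) -> a k ^+ 2 <= limn (sq a).
Proof.
move=> ca; apply: le_trans (sqsum_le_lim k.+1 ca).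
by rewrite /sq seriesSr lerDr; exact: sqsum_ge0.
Qed.

Lemma sqsum_minkowski_part a b c n :
  cvgn (sq a) -> cvgn (sq b) -> (forall k, 0 <= c k <= a k + b k) ->
  Num.sqrt (sq c n) <= Num.sqrt (limn (sq a)) + Num.sqrt (limn (sq b)).
Proof.
move=> ca cb cab.
set A := Num.sqrt (limn (sq a)); set B := Num.sqrt (limn (sq b)).
have A0 : 0 <= A by exact: sqrtr_ge0.
have B0 : 0 <= B by exact: sqrtr_ge0.
have aA : sq a n <= A ^+ 2.
  by rewrite sqr_sqrtr ?sqsum_lim_ge0 //; exact: sqsum_le_lim.
have bB : sq b n <= B ^+ 2.
  by rewrite sqr_sqrtr ?sqsum_lim_ge0 //; exact: sqsum_le_lim.
apply/ler_addgt0Pr => e e0.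
pose A' := A + e / 2; pose B' := B + e / 2.
have A'0 : 0 < A' by rewrite /A'; lra.
have B'0 : 0 < B' by rewrite /B'; lra.
have -> : A + B + e = A' + B' by rewrite /A' /B'; lra.
rewrite -[leRHS]ger0_norm; last by rewrite addr_ge0 // ltW.
rewrite -sqrtr_sqr.
apply: ler_wsqrtr.
pose t := B' / A'; have t0 : 0 < t by exact: divr_gt0.
have step : sq c n <= (1 + t) * sq a n + (1 + t^-1) * sq b n.
  rewrite /sq !seriesEnat /= !mulr_sumr -big_split /=.
  apply: ler_sum => k _; have /andP[c0 ck] := cab k.
  have : c k ^+ 2 <= (a k + b k) ^+ 2 by rewrite lerXn2r ?nnegrE //; lra.
  move=> /le_trans; apply; rewrite -subr_ge0.
  have -> : (1 + t) * a k ^+ 2 + (1 + t^-1) * b k ^+ 2 - (a k + b k) ^+ 2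
            = t^-1 * (t * a k - b k) ^+ 2.
    by field; rewrite gt_eqF.
  by rewrite mulr_ge0 ?sqr_ge0 // invr_ge0 ltW.
apply: le_trans step _.
have AA' : A ^+ 2 <= A' ^+ 2 by rewrite ler_sqr ?nnegrE // ?(ltW A'0) // /A'; lra.
have BB' : B ^+ 2 <= B' ^+ 2 by rewrite ler_sqr ?nnegrE // ?(ltW B'0) // /B'; lra.
have -> : (A' + B') ^+ 2 = (1 + t) * A' ^+ 2 + (1 + t^-1) * B' ^+ 2.
  by rewrite /t; field; rewrite !gt_eqF.
apply: lerD; apply: ler_wpM2l.
- by rewrite addr_ge0 // ltW.
- exact: le_trans AA'.
- by rewrite addr_ge0 // invr_ge0 ltW.
- exact: le_trans BB'.
Qed.

Lemma sqsum_minkowski a b c :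
  cvgn (sq a) -> cvgn (sq b) -> (forall k, 0 <= c k <= a k + b k) ->
  cvgn (sq c) /\
  Num.sqrt (limn (sq c)) <= Num.sqrt (limn (sq a)) + Num.sqrt (limn (sq b)).
Proof.
move=> ca cb cab; set M := Num.sqrt _ + Num.sqrt _.
have M0 : 0 <= M by rewrite addr_ge0 ?sqrtr_ge0.
have cM n : sq c n <= M ^+ 2.
  rewrite -(@sqr_sqrtr _ (sq c n)) ?sqsum_ge0 // lerXn2r ?nnegrE ?sqrtr_ge0 //.
  exact: sqsum_minkowski_part.
have cc : cvgn (sq c) by exact: sqsum_bounded_cvg cM.
split=> //; rewrite -[leRHS]ger0_norm // -sqrtr_sqr; apply: ler_wsqrtr.
by apply: limr_le => //; apply: nearW.
Qed.

Lemma sqsum_scale (t : R) a : cvgn (sq a) ->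
  cvgn (sq (fun k => t * a k)) /\
  limn (sq (fun k => t * a k)) = t ^+ 2 * limn (sq a).
Proof.
move=> ca; have E : sq (fun k => t * a k) = (fun n => t ^+ 2 * sq a n).
  apply/funext => n; rewrite /sq !seriesEnat /= mulr_sumr.
  by apply: eq_bigr => k _; rewrite exprMn.
rewrite E; have cta : (fun n => t ^+ 2 * sq a n) @ \oo --> t ^+ 2 * limn (sq a).
  exact: cvgMr.
split; first exact: cvgP cta.
exact: cvg_lim cta.
Qed.

End sqsum.

Section ell2.
Variable (R : realType).

Definition ell2_pred : {pred (nat -> R[i]^o)} :=
  fun u => `[< cvgn (series (fun k => rnorm (u k) ^+ 2)) >].

Record ell2 := Ell2 { ell2_val :> nat -> R[i]^o ; _ : ell2_val \in ell2_pred }.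

HB.instance Definition _ := [isSub of ell2 for ell2_val].
HB.instance Definition _ := [Choice of ell2 by <:].

Lemma ell2_predP (u : nat -> R[i]^o) :
  reflect (cvgn (series (fun k => rnorm (u k) ^+ 2))) (u \in ell2_pred).
Proof. exact: asboolP. Qed.

Lemma ell2_submod_closed : submod_closed ell2_pred.
Proof.
split=> [|a u v /ell2_predP cu /ell2_predP cv]; apply/ell2_predP.
  apply: (@sqsum_bounded_cvg _ (fun k => rnorm ((0 : nat -> R[i]^o) k)) 0) => n.
  by rewrite seriesEnat /= big1 // => i _; rewrite rnorm0 expr0n.
have [cau _] := sqsum_scale (rnorm (a : R[i]^o)) cu.
have [] // := sqsum_minkowski (c := fun k => rnorm ((a *: u + v) k)) cau cv.
by move=> k; rewrite rnorm_ge0 /= -rnormZ rnormD.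
Qed.

HB.instance Definition _ :=
  GRing.isSubmodClosed.Build R[i] (nat -> R[i]^o) ell2_pred ell2_submod_closed.
HB.instance Definition _ := [SubChoice_isSubLmodule of ell2 by <:].

Definition ell2_norm (u : ell2) : R[i] :=
  (Num.sqrt (limn (series (fun k => rnorm (u k) ^+ 2))))%:C.

Lemma ell2_cvg (u : ell2) : cvgn (series (fun k => rnorm (u k) ^+ 2)).
Proof. by apply/ell2_predP; exact: valP u. Qed.
Arguments ell2_cvg : clear implicits.

Lemma ell2_normD (u v : ell2) :
  ell2_norm (u + v) <= ell2_norm u + ell2_norm v.
Proof.
rewrite /ell2_norm -raddfD /= lecR.
have [] // := sqsum_minkowski (c := fun k => rnorm ((u + v) k))
  (ell2_cvg u) (ell2_cvg v).
by move=> k; rewrite rnorm_ge0 /= rnormD.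
Qed.

Lemma ell2_normZ (a : R[i]) (u : ell2) :
  ell2_norm (a *: u) = `|a| * ell2_norm u.
Proof.
rewrite /ell2_norm.
rewrite (_ : `|a| = (rnorm (a : R[i]^o))%:C); last by rewrite rnormE.
rewrite -rmorphM /=; congr (_%:C).
have [_] := sqsum_scale (rnorm (a : R[i]^o)) (ell2_cvg u).
rewrite (_ : (fun k => (rnorm (a : R[i]^o) * rnorm (u k)) ^+ 2) =
            (fun k => rnorm ((a *: u) k) ^+ 2)); last first.
  by apply/funext => k; rewrite -rnormZ.
move=> ->; rewrite sqrtrM ?sqr_ge0 // sqrtr_sqr ger0_norm //.
exact: rnorm_ge0.
Qed.

Lemma ell2_norm_coord (u : ell2) k : `|u k| <= ell2_norm u.
Proof.
rewrite /ell2_norm -rnormE lecR -[leLHS]ger0_norm ?rnorm_ge0 // -sqrtr_sqr.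
by apply: ler_wsqrtr; exact: (sqsum_term k (ell2_cvg u)).
Qed.

Lemma ell2_norm0_eq0 (u : ell2) : ell2_norm u = 0 -> u = 0.
Proof.
move=> u0; apply/val_inj/funext => k; apply/eqP; rewrite -normr_le0.
by rewrite -u0; exact: ell2_norm_coord.
Qed.

HB.instance Definition _ := Lmodule_isNormed.Build R[i] ell2
  ell2_normD ell2_normZ ell2_norm0_eq0.

End ell2.

Section hinf.
Variable (R : realType).

Definition holomorphic (V W : normedModType R[i]) (f : V -> W) : Prop :=
  forall x, uball x -> differentiable f x.

Definition on_ball (V W : normedModType R[i]) (f : V -> W) : V -> W :=
  fun x => if `|x| < 1 then f x else 0.

Lemma unif_contP (V W : normedModType R[i]) (f : V -> W) :
  unif_continuous (f : subspace (@uball R V) -> W) <->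
  (forall e : R, 0 < e -> exists2 d : R, 0 < d & forall x y, uball x ->
     uball y -> rnorm (x - y) < d -> rnorm (f x - f y) < e).
Proof.
split=> [uf e e0|uf E].
  have eC : 0 < e%:C by rewrite ltcR.
  have /uf := entourage_ball W (PosNum eC).
  case=> E /=; rewrite -entourage_ballE => -[d /= d0 dE] Ef.
  have dR : d = (complex.Re d)%:C by rewrite RRe_real // gtr0_real.
  exists (complex.Re d); first by rewrite -ltcR -dR.
  move=> x y Bx By; rewrite -ltcR rnormE -dR => xy.
  have : ball (f x) e%:C (f y).
    apply: (Ef (x, y)); right; do 2!split=> //.
    by apply: dE; rewrite /= -ball_normE.
  by rewrite -ball_normE /= -rnormE ltcR.
rewrite -entourage_ballE => -[e /= e0 eE].
have eR : e = (complex.Re e)%:C by rewrite RRe_real // gtr0_real.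
have [|d d0 df] := uf (complex.Re e); first by rewrite -ltcR -eR.
have dC : 0 < d%:C by rewrite ltcR.
exists [set xy : V * V | ball xy.1 d%:C xy.2].
  exact: (entourage_ball V (PosNum dC)).
move=> [x y] /= [->|[Bx [By xy]]]; apply: eE => /=; first exact: ballxx.
move: xy; rewrite -ball_normE /= -rnormE ltcR => xy.
by rewrite -ball_normE /= -rnormE eR ltcR; exact: df.
Qed.

Lemma unif_cont_bounded (V W : normedModType R[i]) (f : V -> W) :
  unif_continuous (f : subspace (@uball R V) -> W) ->
  exists M : R, forall x, uball x -> rnorm (f x) <= M.
Proof.
move=> /unif_contP /(_ 1 ltr01) [d d0 df].
pose n := (Num.truncn d^-1).+1.
have nd : n%:R^-1 < d.
  by rewrite -[ltRHS]invrK ltf_pV2 ?posrE ?invr_gt0 // truncnS_gt.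
exists (rnorm (f 0) + n%:R) => x Bx.
have x1 : rnorm x < 1 by rewrite -ltcR rnormE.
pose p (k : nat) : V := ((k%:R / n%:R)%:C : R[i]) *: x.
have rp (t : R) : 0 <= t -> rnorm (t%:C *: x) = t * rnorm x.
  move=> t0; rewrite rnormZ; congr (_ * _).
  by rewrite /rnorm ger0_norm // ler0c.
have pB k : (k <= n)%N -> uball (p k).
  move=> kn; rewrite /uball /= -rnormE ltcR rp ?divr_ge0 //.
  apply: le_lt_trans x1; rewrite ler_piMl ?rnorm_ge0 //.
  by rewrite ler_pdivrMr ?ltr0n // mul1r ler_nat.
have pk k : (k <= n)%N -> rnorm (f (p k)) <= rnorm (f 0) + k%:R.
  elim: k => [_|k IH kn]; first by rewrite /p mul0r scale0r addr0.
  rewrite -(subrK (f (p k)) (f (p k.+1))) addrC.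
  apply: le_trans (rnormD _ _) _; rewrite -natr1 addrA.
  apply: lerD; first exact/IH/ltnW.
  apply/ltW/df; [exact: pB|exact/pB/ltnW|].
  rewrite -scalerBl -rmorphB /= -mulrBl -natr1 addrAC subrr add0r mul1r.
  rewrite rp ?invr_ge0 //; apply: le_lt_trans nd.
  by rewrite ler_piMr ?invr_ge0 // ltW.
have := pk n (leqnn n); rewrite /p divff ?pnatr_eq0 //.
by rewrite scale1r.
Qed.

Section def.
Variables (V W : normedModType R[i]).
Implicit Types f g : V -> W.

Lemma on_ball_in f x : uball x -> on_ball f x = f x.
Proof. by rewrite /on_ball /uball /= => ->. Qed.

Lemma on_ball_out f x : ~ uball x -> on_ball f x = 0.
Proof. by rewrite /on_ball /uball /= => /negP/negbTE ->. Qed.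

Lemma holomorphic_on_ball f : holomorphic f -> holomorphic (on_ball f).
Proof.
move=> hf x Bx; apply: near_differentiable (hf x Bx).
by apply: filterS (uball_nbhs Bx) => y By; rewrite on_ball_in.
Qed.

(* hinf V W is the space H^oo(B_V, W) of bounded holomorphic maps B_V -> W.
   Maps on the open unit ball are encoded as total maps vanishing outside of it,
   so that two of them are equal exactly when they agree on the ball. *)
Definition hinf_pred : {pred (V -> W)} := fun f =>
  `[< [/\ forall x, ~ uball x -> f x = 0, holomorphic f &
          exists M : R, forall x, uball x -> rnorm (f x) <= M] >].

Record hinf := Hinf { hinf_val :> V -> W ; _ : hinf_val \in hinf_pred }.

HB.instance Definition _ := [isSub of hinf for hinf_val].
HB.instance Definition _ := [Choice of hinf by <:].

Lemma hinf_predP f : reflect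
  [/\ forall x, ~ uball x -> f x = 0, holomorphic f &
      exists M : R, forall x, uball x -> rnorm (f x) <= M] (f \in hinf_pred).
Proof. exact: asboolP. Qed.

Lemma hinf_submod_closed : submod_closed hinf_pred.
Proof.
split=> [|a f g /hinf_predP[f0 hf [M fM]] /hinf_predP[g0 hg [N gN]]].
  apply/hinf_predP; split=> //; try by move=> x _; exact: differentiable_cst.
  by exists 0 => x _; rewrite -[X in rnorm X]/(0 : W) rnorm0.
apply/hinf_predP; split.
- by move=> x Bx; rewrite !fctE f0 // g0 // scaler0 addr0.
- move=> x Bx; apply: differentiableD; last exact: hg.
  exact/differentiableZ/hf.
- exists (rnorm (a : R[i]^o) * M + N) => x Bx.
  apply: le_trans (rnormD _ _) _; rewrite lerD ?gN // rnormZ.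
  by rewrite ler_wpM2l ?rnorm_ge0 ?fM.
Qed.

HB.instance Definition _ :=
  GRing.isSubmodClosed.Build R[i] (V -> W) hinf_pred hinf_submod_closed.
HB.instance Definition _ := [SubChoice_isSubLmodule of hinf by <:].

Implicit Types h : hinf.

Lemma hinf_out h x : ~ uball x -> h x = 0.
Proof. by have /hinf_predP[h0 _ _] := valP h; exact: h0. Qed.

Lemma hinf_holomorphic h : holomorphic h.
Proof. by have /hinf_predP[_ hh _] := valP h. Qed.

Lemma hinf_bounded h : exists M : R, forall x, uball x -> rnorm (h x) <= M.
Proof. by have /hinf_predP[_ _ hM] := valP h. Qed.

Lemma hinfP h h' : (forall x, uball x -> h x = h' x) -> h = h'.
Proof.
move=> hh; apply/val_inj/funext => x; have [Bx|nBx] := pselect (uball x).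
  exact: hh.
by rewrite [LHS]hinf_out // [RHS]hinf_out.
Qed.

Definition hinf_norm h : R[i] := (sup [set rnorm (h x) | x in uball])%:C.

Lemma hinf_has_sup h : has_sup [set rnorm (h x) | x in uball].
Proof.
split; first by exists (rnorm (h 0)), 0 => //; exact: uball0.
by have [M hM] := hinf_bounded h; exists M => _ [x Bx <-]; exact: hM.
Qed.

Lemma hinf_norm_ge h x : uball x -> `|h x| <= hinf_norm h.
Proof.
move=> Bx; rewrite /hinf_norm -rnormE lecR.
by apply: ub_le_sup; [exact: (hinf_has_sup h).2|exists x].
Qed.

Lemma hinf_norm_le h (M : R) : (forall x, uball x -> rnorm (h x) <= M) ->
  hinf_norm h <= M%:C.
Proof.
move=> hM; rewrite /hinf_norm lecR; apply: ge_sup.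
  exact: (hinf_has_sup h).1.
by move=> _ [x Bx <-]; exact: hM.
Qed.

Lemma hinf_normD h h' : hinf_norm (h + h') <= hinf_norm h + hinf_norm h'.
Proof.
rewrite {2 3}/hinf_norm -raddfD /=; apply: hinf_norm_le => x Bx.
apply: le_trans (rnormD _ _) _.
by rewrite lerD // -lecR rnormE hinf_norm_ge.
Qed.

Lemma hinf_normZ (a : R[i]) h : hinf_norm (a *: h) = `|a| * hinf_norm h.
Proof.
have le (b : R[i]) k : hinf_norm (b *: k) <= `|b| * hinf_norm k.
  rewrite {2}/hinf_norm (_ : `|b| = (rnorm (b : R[i]^o))%:C); last first.
    by rewrite rnormE.
  rewrite -rmorphM /=; apply: hinf_norm_le => x Bx.
  rewrite -lecR [leRHS]rmorphM /= !rnormE normrZ ler_wpM2l //.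
  exact: hinf_norm_ge.
apply/eqP; rewrite eq_le le /=; have [->|a0] := eqVneq a 0.
  by rewrite normr0 mul0r scale0r (le_trans _ (hinf_norm_ge _ (uball0 V))).
rewrite -ler_pdivlMl ?normr_gt0 // -normfV; apply: le_trans (le _ _).
by rewrite scalerA mulVf // scale1r.
Qed.

Lemma hinf_norm0_eq0 h : hinf_norm h = 0 -> h = 0.
Proof.
move=> h0; apply: hinfP => x Bx; apply/eqP; rewrite -normr_le0.
by rewrite -h0; exact: hinf_norm_ge.
Qed.

HB.instance Definition _ := Lmodule_isNormed.Build R[i] hinf
  hinf_normD hinf_normZ hinf_norm0_eq0.

Lemma hinf_on_ball f (M : R) : holomorphic f ->
  (forall x, uball x -> rnorm (f x) <= M) -> on_ball f \in hinf_pred.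
Proof.
move=> hf fM; apply/hinf_predP; split; first exact: on_ball_out.
- exact: holomorphic_on_ball.
- by exists M => x Bx; rewrite on_ball_in ?fM.
Qed.

Lemma hcst_subproof (w : W) : on_ball (cst w) \in hinf_pred.
Proof.
by apply: (@hinf_on_ball _ (rnorm w)) => // x _; exact: differentiable_cst.
Qed.

Definition hcst (w : W) : hinf := Hinf (hcst_subproof w).

End def.

Section algebra.
Variable (V : normedModType R[i]).
Notation H := (hinf V R[i]^o).

Lemma hmul_subproof (f g : H) : (f : V -> R[i]^o) \* g \in @hinf_pred V R[i]^o.
Proof.
have [M fM] := hinf_bounded f; have [N gN] := hinf_bounded g.
apply/hinf_predP; split.
- by move=> x Bx; rewrite /= [f x]hinf_out // mul0r.
- move=> x Bx; apply: (@differentiableM R[i] V); exact: hinf_holomorphic.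
- exists (M * N) => x Bx; rewrite /= -[_ * _]/(_ *: _ : R[i]^o) rnormZ.
  by rewrite ler_pM ?rnorm_ge0 ?fM ?gN.
Qed.

Definition hmul (f g : H) : H := Hinf (hmul_subproof f g).
Definition hone : H := hcst V (1 : R[i]^o).

Fact hmulA : associative hmul.
Proof. by move=> f g h; apply: hinfP => x Bx /=; rewrite mulrA. Qed.
Fact hmulC : commutative hmul.
Proof. by move=> f g; apply: hinfP => x Bx /=; rewrite mulrC. Qed.
Fact hmul1 : left_id hone hmul.
Proof. by move=> f; apply: hinfP => x Bx /=; rewrite on_ball_in //= mul1r. Qed.
Fact hmulDl : left_distributive hmul +%R.
Proof. by move=> f g h; apply: hinfP => x Bx /=; rewrite mulrDl. Qed.
Fact hone_neq0 : hone != 0.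
Proof.
apply/eqP => /(congr1 (fun h : H => h 0)) /=.
by rewrite on_ball_in; [move/eqP; rewrite oner_eq0|exact: uball0].
Qed.

HB.instance Definition _ := GRing.Zmodule_isComNzRing.Build H
  hmulA hmulC hmul1 hmulDl hone_neq0.

Fact hscaleAl (a : R[i]) (f g : H) : a *: (f * g) = a *: f * g.
Proof. by apply: hinfP => x Bx /=; exact: mulrA. Qed.

HB.instance Definition _ := GRing.Lmodule_isLalgebra.Build R[i] H hscaleAl.
HB.instance Definition _ := GRing.Lalgebra_isComAlgebra.Build R[i] H.

Definition au_pred : {pred H} :=
  fun f => `[< unif_continuous (f : subspace (@uball R V) -> R[i]^o) >].


Lemma au_subalg_closed : subalg_closed au_pred.
Proof.
split.
- apply/asboolP/unif_contP => e e0; exists 1 => // x y Bx By _.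
  by rewrite /= !on_ball_in //= subrr rnorm0.
- move=> a f g /asboolP/unif_contP uf /asboolP/unif_contP ug.
  apply/asboolP/unif_contP => e e0.
  have a1 : 0 < rnorm (a : R[i]^o) + 1 by rewrite ltr_pwDr ?rnorm_ge0.
  have [|d d0 df] := uf (e / 2 / (rnorm (a : R[i]^o) + 1)).
    by rewrite !divr_gt0.
  have [|d' d'0 dg] := ug (e / 2); first by rewrite divr_gt0.
  exists (Num.min d d'); first by rewrite lt_min d0.
  move=> x y Bx By; rewrite lt_min => /andP[xd xd'].
  have -> : (a *: f + g : H) x - (a *: f + g : H) y =
            (a *: (f x - f y) + (g x - g y)) :> R[i]^o.
    by rewrite scalerBr addrACA -opprD.
  apply: le_lt_trans (rnormD _ _) _; rewrite [ltRHS]splitr.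
  apply: ler_ltD; last exact: dg.
  rewrite rnormZ; have := df x y Bx By xd; rewrite ltr_pdivlMr // => /ltW.
  apply: le_trans; rewrite mulrC ler_wpM2l ?rnorm_ge0 // lerDl ler01 //.
- move=> f g /asboolP/unif_contP uf /asboolP/unif_contP ug.
  apply/asboolP/unif_contP => e e0.
  have [M fM] := hinf_bounded f; have [N gN] := hinf_bounded g.
  have M0 : 0 <= M by exact: le_trans (rnorm_ge0 _) (fM 0 (uball0 V)).
  have N0 : 0 <= N by exact: le_trans (rnorm_ge0 _) (gN 0 (uball0 V)).
  have M1 : 0 < M + 1 by rewrite ltr_pwDr.
  have N1 : 0 < N + 1 by rewrite ltr_pwDr.
  have [|d d0 df] := uf (e / 2 / (N + 1)); first by rewrite !divr_gt0.
  have [|d' d'0 dg] := ug (e / 2 / (M + 1)); first by rewrite !divr_gt0.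
  exists (Num.min d d'); first by rewrite lt_min d0.
  move=> x y Bx By; rewrite lt_min => /andP[xd xd'].
  have -> : (f * g : H) x - (f * g : H) y =
            (f x *: (g x - g y) + g y *: (f x - f y)) :> R[i]^o.
    have E (p q r s : R[i]) : p * q - r * s = p * (q - s) + s * (p - r).
      by ring.
    exact: E.
  apply: le_lt_trans (rnormD _ _) _; rewrite [ltRHS]splitr !rnormZ.
  apply: ltr_leD.
    have := dg x y Bx By xd'; rewrite ltr_pdivlMr //; apply: le_lt_trans.
    rewrite mulrC ler_wpM2l ?rnorm_ge0 //.
    by apply: le_trans (fM x Bx) _; rewrite lerDl ler01.
  have := df x y Bx By xd; rewrite ltr_pdivlMr // => /ltW; apply: le_trans.
  rewrite mulrC ler_wpM2l ?rnorm_ge0 //.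
  by apply: le_trans (gN y By) _; rewrite lerDl ler01.
Qed.

(* au V is the algebra A_u(B_V) of uniformly continuous holomorphic functions.
   By unif_cont_bounded the bound that membership in hinf carries holds for every
   uniformly continuous map on the ball. *)
Record au := Au { au_val :> H ; _ : au_val \in au_pred }.

HB.instance Definition _ := [isSub of au for au_val].
HB.instance Definition _ := [Choice of au by <:].
HB.instance Definition _ :=
  GRing.isSubalgClosed.Build R[i] H au_pred au_subalg_closed.
HB.instance Definition _ := [SubChoice_isSubAlgebra of au by <:].
HB.instance Definition _ := [SubNzRing_isSubComNzRing of au by <:].

Lemma au_on_ball (f : V -> R[i]^o) : holomorphic f ->
  unif_continuous (f : subspace (@uball R V) -> R[i]^o) ->
  exists F : au, forall x, uball x -> au_val F x = f x.
Proof.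
move=> hf uf; have [M fM] := unif_cont_bounded uf.
have hF := hinf_on_ball hf fM.
have aF : Hinf hF \in au_pred.
  apply/asboolP/unif_contP => e e0.
  have /unif_contP /(_ e e0) [d d0 df] := uf; exists d => // x y Bx By xy.
  by rewrite /= !on_ball_in //; exact: df.
by exists (Au aF) => x Bx; rewrite /= on_ball_in.
Qed.

End algebra.
End hinf.

Section ell2_coord.
Variable (R : realType).
Notation E := (ell2 R).

Definition ell2_coord (n : nat) (x : E) : R[i]^o := x n.

Fact ell2_coord_is_linear n : linear (ell2_coord n).
Proof. by []. Qed.

HB.instance Definition _ n :=
  GRing.isLinear.Build R[i] E R[i]^o *:%R (ell2_coord n) (ell2_coord_is_linear n).

Lemma ell2_coord_le n (x : E) : `|ell2_coord n x| <= `|x|.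
Proof. exact: ell2_norm_coord. Qed.

Lemma ell2_coord_continuous n : continuous (ell2_coord n).
Proof.
apply: bounded_linear_continuous; apply/linear_boundedP; near=> M.
move=> x; apply: le_trans (ell2_coord_le n x) _; rewrite ler_peMl //.
Unshelve. all: by end_near. Qed.

Lemma ell2_coord_hinf_subproof n : on_ball (ell2_coord n) \in @hinf_pred R E R[i]^o.
Proof.
apply: (@hinf_on_ball _ _ _ _ 1) => x Bx.
  exact/linear_differentiable/ell2_coord_continuous.
by rewrite -lecR rnormE (le_trans (ell2_coord_le n x)) // ltW.
Qed.

Lemma ell2_coord_au_subproof n : Hinf (ell2_coord_hinf_subproof n) \in @au_pred R E.
Proof.
apply/asboolP/unif_contP => e e0; exists e => // x y Bx By.
apply: le_lt_trans; rewrite /= !on_ball_in // -linearB -lecR !rnormE.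
exact: ell2_coord_le.
Qed.

(* <x, e_n> is the n-th coordinate of x. *)
Definition ell2_coord_au n : au E := Au (ell2_coord_au_subproof n).

End ell2_coord.

Definition nonzero_alg_hom (K : comNzRingType) (A B : algType K)
    (Phi : A -> B) : Prop :=
  [/\ linear Phi, {morph Phi : f g / f * g} & exists f, Phi f != 0].

(* The supremum is taken in \bar R because sup of an unbounded set of reals is 0,
   which would give every unbounded operator the norm 0. *)
Definition opnorm (R : realType) (V W : normedModType R[i]) (P : V -> W)
    : \bar R :=
  ereal_sup [set (rnorm (P x))%:E | x in [set x : V | `|x| <= 1]].

Section vector_valued_spectrum.
Variable (R : realType).
Notation E := (ell2 R).
Notation AE := (au E).
Notation HE := (hinf E R[i]^o).

Definition vspectrum : set (AE -> HE) := [set Phi | nonzero_alg_hom Phi].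

(* xi Phi is the projection of Phi, with xi Phi x given as the sequence of its
   coordinates; fiber compares it with the sequence underlying g x : ell2 R. *)
Definition xi (Phi : AE -> HE) (x : E) : nat -> R[i]^o :=
  fun n => Phi (ell2_coord_au R n) x.

Definition fiber (g : hinf E E) : set (AE -> HE) :=
  vspectrum `&` [set Phi | forall x, uball x -> xi Phi x = g x].

Definition analytic (X : normedModType R[i]) (Psi : X -> AE -> HE) : Prop :=
  forall (f : AE) (x : E), uball x ->
    holomorphic (fun h : X => Psi h f x : R[i]^o).

End vector_valued_spectrum.

(* Main.v *)
From HB Require Import structures.
Require Import Defs.
From mathcomp Require Import all_boot all_order all_algebra complex.
From mathcomp Require Import all_classical all_reals all_analysis.
From mathcomp Require Import ring lra.

Set Implicit Arguments.
Unset Strict Implicit.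
Unset Printing Implicit Defensive.

Import Order.TTheory GRing.Theory Num.Theory.
Import numFieldNormedType.Exports.

Local Open Scope classical_set_scope.
Local Open Scope ring_scope.
Local Open Scope complex_scope.

(* Let v <> 0 be in the kernel of P. The Schwarz lemma and hypothesis (1) give
   |g x| = |g (P x)| <= |g 0| + (1 - |g 0|) |P x|, while |P x|^2 <= |x|^2 - |<x, v>|^2 / |v|^2;
   hence |g x|^2 + |l x|^2 |w|^2 < 1 on the ball whenever |w| <= 2, for l a small multiple
   of <., v>. Partition the coordinates into infinitely many infinite blocks, let
   z_n(x) be g x with its n-th block replaced by l(x) (1, h x), and put
   Psi h f x = lim_U f (z_n(x)) for a nonprincipal ultrafilter U. Coordinatewise
   z_n(x) tends to g x, so Psi h is in the fiber over g. A quadratic form summing the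
   products of the entries 0 and j + 1 of every block takes on z_n(x) a value that
   depends on h only through l(x)^2 (h x)_j, which gives injectivity.
   Limits along U of uniformly bounded holomorphic functions are holomorphic because
   the quadratic Taylor remainder is uniform. This follows from the Schwarz lemma alone,
   and the latter from the mean value property, that is from Goursat's theorem in
   logarithmic coordinates. *)

(** * Goursat's theorem for real closed forms *)

(** Elements of [au E] are controlled on the open ball only, so every evaluation point has to stay
    strictly inside it. This is why a block of [g x] is replaced and nothing is added to it: the two
    parts have disjoint supports, their squared norms add, and the quadratic gap won from [v] is
    exactly what this sum needs. The coordinate functionals agree on the whole fiber, hence the
    detection by a quadratic form. The leading 1 of each inserted block makes the dependence of that
    form on [h] affine, so no sign ambiguity arises, and the remaining factor vanishes only on the
    hyperplane [l x = 0], whose complement is dense. The limit is taken along an ultrafilter because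
    it must exist for all [f] at once and be multiplicative. The price is that holomorphy has to
    survive a merely pointwise limit, which is what the one-variable theory is built for; there,
    every path integral is kept as an increment of a real primitive. *)

Section goursat.
Variable R : realType.

(** Path integrals are represented below by increments of such primitives, which turns estimates of
    integrals into applications of the mean value theorem. *)
Lemma continuous_primitive (f : R -> R) (B : R) : continuous f ->
  exists F : R -> R, forall x : R, `|x| < B -> is_derive x 1 F (f x).
Proof.
move=> cf.
exists (fun x => \int[lebesgue_measure]_(t in `[- B, x]) f t)%R => x.
rewrite ltr_norml => /andP[Bx xB].
have fi : (@lebesgue_measure R).-integrable `[- B, B] (EFin \o f).
  apply: continuous_compact_integrable; first exact: segment_compact.
  exact: continuous_subspaceT.
have [dF F'] := continuous_FTC1_closed xB fi Bx (cf x).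
by split; [exact: dF|rewrite -derive1E; exact: F'].
Qed.

(** The mean value theorem for [F \- G]. It stands in for bounding an integral by supremum times
    length. *)
Lemma increment_close (F G f g : R -> R) (a b e : R) : a <= b ->
  (forall x : R, a <= x <= b -> is_derive x 1 F (f x)) ->
  (forall x : R, a <= x <= b -> is_derive x 1 G (g x)) ->
  (forall x, a <= x <= b -> `|f x - g x| <= e) ->
  `|F b - F a - (G b - G a)| <= e * (b - a).
Proof.
move=> ab dF dG fg.
have dFG (x : R) : a <= x <= b -> is_derive x 1 (F \- G) (f x - g x).
  by move=> xab; apply: is_deriveB; [exact: dF|exact: dG].
have [||c cab E] := @MVT_segment R (F \- G) (fun x => f x - g x) a b ab.
- by move=> x; rewrite in_itv /= => /andP[ax xb]; apply: dFG; rewrite !ltW.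
- apply: derivable_within_continuous => x; rewrite in_itv /= => /dFG [].
  by [].
have -> : F b - F a - (G b - G a) = (F \- G) b - (F \- G) a.
  by rewrite /=; ring.
rewrite E normrM [`|b - a|]ger0_norm ?subr_ge0 // ler_wpM2r ?subr_ge0 //.
exact: fg.
Qed.

(** If [Q] failed, every bad square would have a bad quarter, and the nested bad quarters would
    shrink to a point (s, t). The local hypothesis does not centre its squares, because that point
    may sit anywhere in the quarters. *)
Lemma square_bisection (Q : R -> R -> R -> Prop) (a c l : R) : 0 < l ->
  (forall a c l, 0 < l ->
    Q a c (l / 2) -> Q (a + l / 2) c (l / 2) ->
    Q a (c + l / 2) (l / 2) -> Q (a + l / 2) (c + l / 2) (l / 2) -> Q a c l) ->
  (forall s t : R, a <= s <= a + l -> c <= t <= c + l ->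
    exists2 d : R, 0 < d & forall a' c' l', 0 < l' <= d ->
      a' <= s <= a' + l' -> c' <= t <= c' + l' -> Q a' c' l') ->
  Q a c l.
Proof.
move=> l0 Qjoin Qloc; apply: contrapT => nQ.
(* The quarter on which [Q] fails. The fourth one needs no test: if the first three are good,
   [Qjoin] forces it to be bad. *)
pose nxt (x : R * R) (k : R) : R * R :=
  if pselect (Q x.1 x.2 k) is right _ then x else
  if pselect (Q (x.1 + k) x.2 k) is right _ then (x.1 + k, x.2) else
  if pselect (Q x.1 (x.2 + k) k) is right _ then (x.1, x.2 + k) else
  (x.1 + k, x.2 + k).
pose L n : R := l / 2 ^+ n.
have L0 n : 0 < L n by rewrite divr_gt0 // exprn_gt0.
have LS n : L n.+1 = L n / 2 by rewrite /L exprS; field; rewrite expf_neq0.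
pose fix z n : R * R := if n is m.+1 then nxt (z m) (L m.+1) else (a, c).
have nxtE x k : 0 <= k -> [/\ x.1 <= (nxt x k).1 <= x.1 + k
                         & x.2 <= (nxt x k).2 <= x.2 + k].
  move=> k0; rewrite /nxt; do 3?[case: pselect => _ /=]; split; lra.
have nQz n : ~ Q (z n).1 (z n).2 (L n).
  elim: n => [|n IH]; first by rewrite /= /L divr1.
  move=> Qn; apply: IH; move: Qn; rewrite /= /nxt.
  have LE := LS n.
  do 3?[case: pselect => //= ?] => ?.
  by apply: Qjoin => //; rewrite -LE.
have mono n m : (n <= m)%N ->
    [/\ (z n).1 <= (z m).1, (z m).1 + L m <= (z n).1 + L n,
        (z n).2 <= (z m).2 & (z m).2 + L m <= (z n).2 + L n].
  elim: m => [|m IH]; first by rewrite leqn0 => /eqP ->; split.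
  rewrite leq_eqVlt => /orP[/eqP ->|]; first by split.
  rewrite ltnS => /IH[h1 h2 h3 h4].
  have [] := nxtE (z m) (L m.+1) (ltW (L0 _)).
  have := LS m; rewrite /=; set u := nxt _ _; have := L0 m.+1.
  move=> ? ? ? ?; split; lra.
(* Every lower end lies below every upper end, also for different indices, so the suprema [s] and
   [t] belong to all the squares. *)
have ub1 n m : (z n).1 <= (z m).1 + L m /\ (z n).2 <= (z m).2 + L m.
  have [nm|/ltnW mn] := leqP n m.
    have [] := mono _ _ nm; have := L0 m; have := L0 n; split; lra.
  have [] := mono _ _ mn; have := L0 m; have := L0 n; split; lra.
pose s := sup (range (fun n => (z n).1)); pose t := sup (range (fun n => (z n).2)).
have hs n : (z n).1 <= s <= (z n).1 + L n.
  apply/andP; split.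
    apply: ub_le_sup; last by exists n.
    by exists (a + L 0) => _ [m _ <-]; exact: (ub1 m 0%N).1.
  apply: ge_sup; first by exists (z 0).1, 0.
  by move=> _ [m _ <-]; exact: (ub1 m n).1.
have ht n : (z n).2 <= t <= (z n).2 + L n.
  apply/andP; split.
    apply: ub_le_sup; last by exists n.
    by exists (c + L 0) => _ [m _ <-]; exact: (ub1 m 0%N).2.
  apply: ge_sup; first by exists (z 0).2, 0.
  by move=> _ [m _ <-]; exact: (ub1 m n).2.
have [||d d0 Qd] := Qloc s t.
- by have := hs 0%N; rewrite /= /L divr1.
- by have := ht 0%N; rewrite /= /L divr1.
have [n nd] : exists n, L n <= d.
  exists (Num.truncn (l / d)).+1; rewrite /L ler_pdivrMr ?exprn_gt0 //.
  rewrite -ler_pdivrMl // mulrC; apply: ltW.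
  apply: lt_le_trans (truncnS_gt _) _; rewrite -natrX ler_nat.
  exact/ltnW/ltn_expl.
by apply: (nQz n); apply: Qd; rewrite ?L0.
Qed.

(* The form p ds + q dt is differentiable at (s, t) with both cross derivatives
   equal to [pt]. *)
Definition closed_at (p q : R -> R -> R) (s t : R) : Prop :=
  exists ps pt qt : R, forall e : R, 0 < e -> exists2 d : R, 0 < d &
    forall s' t', `|s' - s| <= d -> `|t' - t| <= d ->
      `|p s' t' - (p s t + ps * (s' - s) + pt * (t' - t))|
         <= e * (`|s' - s| + `|t' - t|) /\
      `|q s' t' - (q s t + pt * (s' - s) + qt * (t' - t))|
         <= e * (`|s' - s| + `|t' - t|).

Lemma goursat_square (p q : R -> R -> R) (Fp Fq : R -> R -> R) (a c l : R) :
  0 < l ->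
  (forall s t : R, a <= s <= a + l -> c <= t <= c + l ->
     is_derive s 1 (Fp^~ t) (p s t)) ->
  (forall s t : R, a <= s <= a + l -> c <= t <= c + l ->
     is_derive t 1 (Fq s) (q s t)) ->
  (forall s t, a <= s <= a + l -> c <= t <= c + l -> closed_at p q s t) ->
  Fp (a + l) c - Fp a c + (Fq (a + l) (c + l) - Fq (a + l) c)
  - (Fp (a + l) (c + l) - Fp a (c + l)) - (Fq a (c + l) - Fq a c) = 0.
Proof.
move=> l0 dFp dFq pq.
pose J a c l := Fp (a + l) c - Fp a c + (Fq (a + l) (c + l) - Fq (a + l) c)
  - (Fp (a + l) (c + l) - Fp a (c + l)) - (Fq a (c + l) - Fq a c).
rewrite -[LHS]/(J a c l).
apply/eqP; rewrite -normr_le0; apply/ler_addgt0Pr => e e0; rewrite add0r.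
(* The bound is made proportional to the area, which is additive over the four quarters, so
   bisection loses nothing. *)
pose k := e / l ^+ 2; have k0 : 0 < k by rewrite divr_gt0 // exprn_gt0.
have -> : e = k * l ^+ 2 by rewrite /k divfK // expf_neq0 // gt_eqF.
pose Q a' c' l' := a <= a' -> a' + l' <= a + l -> c <= c' -> c' + l' <= c + l ->
  `|J a' c' l'| <= k * l' ^+ 2.
suff : Q a c l by apply.
apply: square_bisection => // [a' c' l' l'0 Q1 Q2 Q3 Q4 h1 h2 h3 h4|s t sa tc].
  have E : J a' c' l' = J a' c' (l' / 2) + J (a' + l' / 2) c' (l' / 2)
    + J a' (c' + l' / 2) (l' / 2) + J (a' + l' / 2) (c' + l' / 2) (l' / 2).
    rewrite /J.
    have -> : a' + l' / 2 + l' / 2 = a' + l' by field.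
    have -> : c' + l' / 2 + l' / 2 = c' + l' by field.
    by ring.
  rewrite E.
  set x1 := J a' c' _; set x2 := J _ c' _; set x3 := J a' _ _; set x4 := J _ _ _.
  have n1 := ler_normD x1 x2; have n2 := ler_normD (x1 + x2) x3.
  have n3 := ler_normD (x1 + x2 + x3) x4.
  have := Q1; have := Q2; have := Q3; have := Q4; rewrite /Q => {Q1 Q2 Q3 Q4}.
  have h : 0 < l' / 2 by rewrite divr_gt0.
  have lh : l' = l' / 2 + l' / 2 by field.
  do 4![move=> /(_ ltac:(clear -h1 h2 h3 h4 h lh; lra)
    ltac:(clear -h1 h2 h3 h4 h lh; lra) ltac:(clear -h1 h2 h3 h4 h lh; lra)
    ltac:(clear -h1 h2 h3 h4 h lh; lra)) ?].
  have -> : k * l' ^+ 2 = 4 * (k * (l' / 2) ^+ 2) by field.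
  lra.
have [ps [pt [qt loc]]] := pq s t sa tc.
(* On a square of side l' containing (s, t), the two distances sum to at most 2 l'. So k / 8 yields
   k / 4 * l' at each point, k / 4 * l'^2 on each side and k * l'^2 around the square. *)
have [|d d0 {}loc] := loc (k / 8); first by rewrite divr_gt0.
exists d => // a' c' l' /andP[l'0 l'd] sa' tc' h1 h2 h3 h4.
(* Primitives of the linearised form along horizontal and vertical lines. As both cross coefficients
   equal [pt], their signed sum around any square is exactly 0. *)
pose Gp x y := p s t * x + ps * ((x - s) ^+ 2 / 2) + pt * (y - t) * x.
pose Gq x y := q s t * y + pt * (x - s) * y + qt * ((y - t) ^+ 2 / 2).
have dGp (x y : R) : is_derive x 1 (Gp^~ y) (p s t + ps * (x - s) + pt * (y - t)).
  rewrite /Gp; apply: is_derive_eq.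
  by rewrite /GRing.scale /=; field.
have dGq (x y : R) : is_derive y 1 (Gq x) (q s t + pt * (x - s) + qt * (y - t)).
  rewrite /Gq; apply: is_derive_eq.
  by rewrite /GRing.scale /=; field.
have sqr_close x y : a' <= x <= a' + l' -> c' <= y <= c' + l' ->
   `|p x y - (p s t + ps * (x - s) + pt * (y - t))| <= k / 4 * l' /\
   `|q x y - (q s t + pt * (x - s) + qt * (y - t))| <= k / 4 * l'.
  move=> xa yc.
  have xs : `|x - s| <= l' by rewrite ler_norml; apply/andP; split; lra.
  have yt : `|y - t| <= l' by rewrite ler_norml; apply/andP; split; lra.
  have [h5 h6] := loc x y (le_trans xs l'd) (le_trans yt l'd).
  have : k / 8 * (`|x - s| + `|y - t|) <= k / 4 * l'.
    have -> : k / 4 * l' = k / 8 * (l' + l') by field.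
    by rewrite ler_wpM2l ?lerD // ltW // divr_gt0.
  by move=> h7; split; [exact: le_trans h5 h7|exact: le_trans h6 h7].
have hor y : c' <= y <= c' + l' ->
  `|Fp (a' + l') y - Fp a' y - (Gp (a' + l') y - Gp a' y)| <= k / 4 * l' ^+ 2.
  move=> yc; have -> : k / 4 * l' ^+ 2 = k / 4 * l' * (a' + l' - a') by ring.
  apply: (@increment_close (Fp^~ y) (Gp^~ y)
    (p^~ y) (fun x => p s t + ps * (x - s) + pt * (y - t))); first by lra.
  - by move=> x xa; apply: dFp; lra.
  - by move=> x xa; exact: (sqr_close x y xa yc).1.
have ver x : a' <= x <= a' + l' ->
  `|Fq x (c' + l') - Fq x c' - (Gq x (c' + l') - Gq x c')| <= k / 4 * l' ^+ 2.
  move=> xa; have -> : k / 4 * l' ^+ 2 = k / 4 * l' * (c' + l' - c') by ring.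
  apply: (@increment_close (Fq x) (Gq x)
    (q x) (fun y => q s t + pt * (x - s) + qt * (y - t))); first by lra.
  - by move=> y ya; apply: dFq; lra.
  - by move=> y yc; exact: (sqr_close x y xa yc).2.
have E : J a' c' l' =
  (Fp (a' + l') c' - Fp a' c' - (Gp (a' + l') c' - Gp a' c'))
  + (Fq (a' + l') (c' + l') - Fq (a' + l') c'
      - (Gq (a' + l') (c' + l') - Gq (a' + l') c'))
  - (Fp (a' + l') (c' + l') - Fp a' (c' + l')
      - (Gp (a' + l') (c' + l') - Gp a' (c' + l')))
  - (Fq a' (c' + l') - Fq a' c' - (Gq a' (c' + l') - Gq a' c')).
  by rewrite /J /Gp /Gq; field.
rewrite E.
have -> : k * l' ^+ 2 = k / 4 * l' ^+ 2 + k / 4 * l' ^+ 2 + k / 4 * l' ^+ 2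
  + k / 4 * l' ^+ 2 by field.
apply: le_trans (ler_normB _ _) (lerD _ (ver _ _)); last by lra.
apply: le_trans (ler_normB _ _) (lerD _ (hor _ _)); last by lra.
apply: le_trans (ler_normD _ _) (lerD (hor _ _) (ver _ _)); lra.
Qed.

End goursat.

(** * Real-valued norms and differentiability *)

Section rnorm_theory.
Variable R : realType.
Notation C := (R[i]^o).
Notation Re := complex.Re.
Notation Im := complex.Im.

Lemma rnormN (V : normedModType R[i]) (x : V) : rnorm (- x) = rnorm x.
Proof. by rewrite /rnorm normrN. Qed.

Lemma rnormC (V : normedModType R[i]) (x y : V) : rnorm (x - y) = rnorm (y - x).
Proof. by rewrite -opprB rnormN. Qed.

Lemma rnorm_realZ (V : normedModType R[i]) (t : R) (x : V) :
  rnorm (t%:C *: x) = `|t| * rnorm x.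
Proof.
rewrite rnormZ; congr (_ * _); rewrite /rnorm normc_def /=.
by rewrite expr0n addr0 sqrtr_sqr.
Qed.

Lemma uball_rnorm (V : normedModType R[i]) (x : V) : uball x <-> rnorm x < 1.
Proof. by rewrite /uball /= -rnormE ltcR. Qed.

Lemma rnormM (z w : C) : rnorm (z * w : C) = rnorm z * rnorm w.
Proof. exact: (rnormZ z w). Qed.

Lemma rnormX (z : C) n : rnorm (z ^+ n : C) = rnorm z ^+ n.
Proof.
elim: n => [|n IH]; last by rewrite !exprS rnormM IH.
by rewrite !expr0 /rnorm normr1.
Qed.

Lemma rnormV (z : C) : rnorm (z^-1 : C) = (rnorm z)^-1.
Proof.
by apply: complexI; rewrite rnormE fmorphV /= rnormE normfV.
Qed.

Lemma rnorm_real (t : R) : rnorm (t%:C : C) = `|t|.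
Proof. by rewrite -[t%:C]mulr1 (rnorm_realZ t (1 : C)) /rnorm normr1 mulr1. Qed.

Lemma rnorm_sqr (z : C) : rnorm z ^+ 2 = Re z ^+ 2 + Im z ^+ 2.
Proof.
by rewrite /rnorm normc_def /= sqr_sqrtr // addr_ge0 // sqr_ge0.
Qed.

Lemma Re_le_rnorm (z : C) : `|Re z| <= rnorm z.
Proof.
rewrite -[leRHS]ger0_norm ?rnorm_ge0 // -ler_sqr ?nnegrE //.
by rewrite !real_normK ?num_real // rnorm_sqr lerDl sqr_ge0.
Qed.

Lemma Im_le_rnorm (z : C) : `|Im z| <= rnorm z.
Proof.
rewrite -[leRHS]ger0_norm ?rnorm_ge0 // -ler_sqr ?nnegrE //.
by rewrite !real_normK ?num_real // rnorm_sqr lerDr sqr_ge0.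
Qed.

Lemma rnorm_le_ReIm (z : C) : rnorm z <= `|Re z| + `|Im z|.
Proof.
rewrite -[leRHS]ger0_norm ?addr_ge0 // -[leLHS]ger0_norm ?rnorm_ge0 //.
rewrite -ler_sqr ?nnegrE // !real_normK ?num_real // rnorm_sqr.
have := real_normK (num_real (Re z)); have := real_normK (num_real (Im z)).
have : 0 <= `|Re z| * `|Im z| by rewrite mulr_ge0.
by rewrite sqrrD; lra.
Qed.

(** With its converse below, this allows all estimates to be made with real epsilon and delta
    although the norms are valued in [R[i]]. The bound [K] provides the continuity of [D]. *)
Lemma eps_differentiable (V W : normedModType R[i]) (f : V -> W) (x : V)
    (D : {linear V -> W}) (K : R) :
  (forall h, rnorm (D h) <= K * rnorm h) ->
  (forall e : R, 0 < e -> exists2 d : R, 0 < d & forall h, rnorm h <= d ->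
     rnorm (f (x + h) - f x - D h) <= e * rnorm h) ->
  differentiable f x.
Proof.
move=> DK fD.
have cD : continuous D.
  apply: bounded_linear_continuous; apply/linear_boundedP.
  exists (`|K|)%:C; split; first by rewrite complex_real.
  move=> M KM h; apply: le_trans (_ : (`|K| * rnorm h)%:C <= _).
    rewrite -rnormE lecR; apply: le_trans (DK h) _.
    by rewrite ler_wpM2r ?rnorm_ge0 // ler_norm.
  by rewrite rmorphM /= rnormE ler_wpM2r ?normr_ge0 // ltW.
have dg : f \o shift x = cst (f x) + D +o_ 0 id.
  apply/eqaddoP => e e0.
  have eR : e = (Re e)%:C by rewrite RRe_real // gtr0_real.
  have [|d d0 fd] := fD (Re e); first by rewrite -ltcR -eR.
  have dC : 0 < d%:C by rewrite ltcR.
  apply/nbhs_ballP; exists d%:C => //= h; rewrite -ball_normE /= sub0r normrN.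
  rewrite -(rnormE h) ltcR => /ltW /fd; rewrite /= fctE /= opprD addrA => fh.
  by rewrite eR -!rnormE -rmorphM lecR /= addrC [h + x]addrC addrC.
have dE : 'd f x = D :> (V -> W) by exact: diff_unique.
by apply/diff_locallyP; rewrite dE.
Qed.

Lemma differentiable_eps (V W : normedModType R[i]) (f : V -> W) (x : V) :
  differentiable f x ->
  (exists2 K : R, 0 <= K & forall h, rnorm ('d f x h) <= K * rnorm h) /\
  forall e : R, 0 < e -> exists2 d : R, 0 < d & forall h, rnorm h <= d ->
     rnorm (f (x + h) - f x - 'd f x h) <= e * rnorm h.
Proof.
move=> /diff_locallyP[cD fD]; split.
  have /linear_boundedP := (linear_bounded_continuous _).2 cD.
  case=> M [Mreal MD]; pose m := rnorm (M : C) + 1.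
  exists m => [|h]; first by rewrite addr_ge0 ?rnorm_ge0.
  rewrite -lecR rmorphM /= !rnormE; apply: MD.
  rewrite (le_lt_trans (real_ler_norm Mreal)) // /m rmorphD /= rnormE.
  by rewrite ltrDl ltr01.
move=> e e0; move/eqaddoP: fD => /(_ e%:C); rewrite ltcR => /(_ e0).
move=> /nbhs_ballP[d /= d0 fd].
have dR : d = (Re d)%:C by rewrite RRe_real // gtr0_real.
have d'0 : 0 < Re d by rewrite -ltcR -dR.
exists (Re d / 2); first by rewrite divr_gt0.
move=> h hd; have := fd h; rewrite -ball_normE /= sub0r normrN -rnormE dR ltcR.
rewrite fctE /= -!rnormE -rmorphM lecR /= opprD addrA [h + x]addrC; apply.
by apply: le_lt_trans hd _; rewrite ltr_pdivrMr // ltr_pMr // ltrDl.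
Qed.

Lemma differentiable_lipschitz (V W : normedModType R[i]) (f : V -> W) (x : V) :
  differentiable f x ->
  exists2 K : R, 0 < K & exists2 d : R, 0 < d & forall h, rnorm h <= d ->
    rnorm (f (x + h) - f x) <= K * rnorm h.
Proof.
move=> /differentiable_eps[[K K0 DK] /(_ 1 ltr01)[d d0 fd]].
exists (K + 1); first by rewrite ltr_wpDl.
exists d => // h /fd; rewrite mul1r => fh.
rewrite -(subrK ('d f x h) (f (x + h) - f x)); apply: le_trans (rnormD _ _) _.
by rewrite mulrDl mul1r addrC lerD.
Qed.

Lemma diff_complex (f : C -> C) (z h : C) : 'd f z h = h * 'd f z (1 : C).
Proof. by rewrite -[h in LHS]mulr1 -[_ * 1]/(h *: 1 : C) linearZ. Qed.

Lemma eps_complex_differentiable (f : C -> C) (z l : C) :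
  (forall e : R, 0 < e -> exists2 d : R, 0 < d & forall h : C, rnorm h <= d ->
     rnorm (f (z + h) - f z - h * l) <= e * rnorm h) ->
  differentiable f z.
Proof.
move=> fl.
pose D (h : C) : C := h * l.
have Dlin : linear D by move=> a u v; rewrite /D mulrDl -mulrA.
pose HD := GRing.isLinear.Build R[i] C C *:%R D Dlin.
pose D' : {linear C -> C} := HB.pack D HD.
apply: (@eps_differentiable _ _ _ _ D' (rnorm l)) => //.
by move=> h; rewrite /= /D rnormM mulrC.
Qed.

End rnorm_theory.

(** * The complex exponential, mean values and the maximum principle *)

Section cexp.
Variable R : realType.
Notation C := (R[i]^o).
Notation Re := complex.Re.
Notation Im := complex.Im.

(** exp (s + i t) in real coordinates: a circle of radius e^s becomes a vertical segment of length 2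
    pi, the side of a square to which [goursat_square] applies. *)
Definition cexp (s t : R) : C := (expR s * cos t) +i* (expR s * sin t).

Lemma cexpD s t s' t' : cexp (s + s') (t + t') = cexp s t * cexp s' t'.
Proof.
apply/eqP; rewrite eq_complex /= expRD cosD sinD; apply/andP; split; apply/eqP; ring.
Qed.

Lemma rnorm_cexp s t : rnorm (cexp s t) = expR s.
Proof.
apply/eqP; rewrite -(eqrXn2 (n := 2)) ?rnorm_ge0 ?expR_ge0 // rnorm_sqr /=.
by rewrite !exprMn -mulrDr cos2Dsin2 mulr1.
Qed.

Lemma cexp_periodic s : cexp s (2 * pi) = cexp s 0.
Proof.
rewrite /cexp; have -> : 2 * pi = 0 + pi *+ 2 :> R by rewrite add0r mulr2n; ring.
by rewrite cosD2pi sinD2pi.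
Qed.

(** Both halves come from 1 + x <= exp x: at s it is the lower bound, at -s it gives exp s * (1 - s)
    <= 1 and hence the upper one. *)
Lemma expR_quadratic (s : R) : `|s| <= 1 / 2 -> `|expR s - 1 - s| <= 2 * s ^+ 2.
Proof.
rewrite ler_norml => /andP[s1 s2].
have h1 := expR_ge1Dx s; have h2 := expR_ge1Dx (- s).
have E0 := expR_gt0 s.
have hE : expR s * (1 - s) <= 1.
  have {2}<- : expR s * expR (- s) = 1 by rewrite expRN divff // gt_eqF.
  by rewrite ler_wpM2l ?expR_ge0.
rewrite ler_norml; apply/andP; split; first by have := sqr_ge0 s; lra.
have h3 : expR s * (1 - s) <= (1 + s + 2 * s ^+ 2) * (1 - s).
  apply: le_trans hE _; rewrite -subr_ge0.
  have -> : (1 + s + 2 * s ^+ 2) * (1 - s) - 1 = s ^+ 2 * (1 - 2 * s) by ring.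
  by rewrite mulr_ge0 ?sqr_ge0 //; lra.
have h4 : 0 < 1 - s by lra.
by have := h3; rewrite ler_pM2r // => ?; lra.
Qed.

(** Each bound is the previous one integrated: |cos| <= 1 controls sin, this controls cos - 1, and
    this controls sin t - t. Parity covers negative t. *)
Lemma sin_cos_quadratic (t : R) : `|t| <= 1 ->
  [/\ `|sin t| <= `|t|, `|cos t - 1| <= t ^+ 2 & `|sin t - t| <= t ^+ 2].
Proof.
have pos (x : R) : 0 <= x -> x <= 1 ->
  [/\ `|sin x| <= x, `|cos x - 1| <= x ^+ 2 & `|sin x - x| <= x ^+ 2].
  move=> x0 x1.
  have h1 (y : R) : 0 <= y -> `|sin y| <= y.
    move=> y0; have := @increment_close R sin (fun=> 0) cos (fun=> 0) 0 y 1 y0.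
    rewrite sin0 !subr0 mul1r; apply.
    by move=> z _; rewrite subr0 ler_norml cos_le1 cos_geN1.
  have h2 (y : R) : 0 <= y -> `|cos y - 1| <= y ^+ 2.
    move=> y0; have := @increment_close R cos (fun=> 0) (fun z => - sin z)
      (fun=> 0) 0 y y y0.
    rewrite cos0 !subr0 expr2; apply.
    by move=> z /andP[z0 zy]; rewrite subr0 normrN (le_trans (h1 z z0)).
  split; [exact: h1|exact: h2|].
  have := @increment_close R sin id cos (fun=> 1) 0 x x x0.
  rewrite sin0 !subr0 expr2; apply.
  move=> z /andP[z0 zx]; apply: le_trans (h2 z z0) _; rewrite expr2.
  by rewrite -[leRHS]mulr1 ler_pM // (le_trans zx).
rewrite ler_norml => /andP[t1 t2].
have [t0|/ltW t0] := leP 0 t; first by rewrite (ger0_norm t0); exact: pos.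
have [||h1 h2 h3] := pos (- t); [by rewrite oppr_ge0|by lra|].
move: h1 h2 h3; rewrite sinN cosN normrN sqrrN (ler0_norm t0) => -> ->.
by rewrite -opprD normrN => ->.
Qed.

Lemma cexp_quadratic (s t : R) : `|s| <= 1 / 2 -> `|t| <= 1 / 2 ->
  rnorm (cexp s t - 1 - (s +i* t) : C) <= 4 * rnorm (s +i* t : C) ^+ 2.
Proof.
move=> s1 t1; have E := expR_quadratic s1.
have [|S C1 S1] := @sin_cos_quadratic t; first by apply: le_trans t1 _; lra.
apply: le_trans (rnorm_le_ReIm _) _; rewrite rnorm_sqr /=.
have -> : expR s * cos t - 1 - s = (expR s - 1 - s) * cos t + (1 + s) * (cos t - 1).
  by ring.
have -> : expR s * sin t - 0 - t = (expR s - 1) * sin t + (sin t - t) by ring.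
have h1 : `|(expR s - 1 - s) * cos t| <= 2 * s ^+ 2.
  by rewrite normrM -[leRHS]mulr1 ler_pM // ler_norml cos_le1 cos_geN1.
have h2 : `|(1 + s) * (cos t - 1)| <= 3 / 2 * t ^+ 2.
  rewrite normrM ler_pM // ; apply: le_trans (ler_normD _ _) _.
  by rewrite normr1; lra.
have h3 : `|(expR s - 1) * sin t| <= 2 * `|s| * `|t|.
  rewrite normrM ler_pM // -(subrK s (expR s - 1)).
  apply: le_trans (ler_normD _ _) _.
  have -> : 2 * `|s| = `|s| + `|s| by ring.
  rewrite lerD2r; apply: le_trans E _; rewrite -real_normK ?num_real //.
  have := normr_ge0 s; move: (`|s|) s1 => x x1 x0; rewrite expr2 mulrA.
  by rewrite -[leRHS]mul1r ler_wpM2r //; lra.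
have h4 := ler_normD ((expR s - 1 - s) * cos t) ((1 + s) * (cos t - 1)).
have h5 := ler_normD ((expR s - 1) * sin t) (sin t - t).
have h6 : 2 * `|s| * `|t| <= s ^+ 2 + t ^+ 2.
  rewrite -(real_normK (num_real s)) -(real_normK (num_real t)) -subr_ge0.
  have -> : `|s| ^+ 2 + `|t| ^+ 2 - 2 * `|s| * `|t| = (`|s| - `|t|) ^+ 2 by ring.
  exact: sqr_ge0.
(* The bounds collected so far add up to 3 s^2 + 7/2 t^2, which the constant 4 covers. *)
have h7 := sqr_ge0 s; have h8 := sqr_ge0 t.
by clear -h1 h2 h3 h4 h5 h6 h7 h8 S1; lra.
Qed.

Lemma cexp_differentiable (w : C) :
  differentiable (fun w : C => cexp (Re w) (Im w)) w.
Proof.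
apply: (@eps_complex_differentiable _ _ _ (cexp (Re w) (Im w))) => e e0.
pose m := expR (Re w); have m0 : 0 < m := expR_gt0 _.
exists (Num.min (1 / 2) (e / (4 * m))).
  by rewrite lt_min !divr_gt0 // mulr_gt0.
case=> s t; rewrite le_min => /andP[h1 h2].
have -> : (cexp (Re (w + (s +i* t))) (Im (w + (s +i* t))) : C) =
  cexp (Re w) (Im w) * cexp s t by case: w @m m0 h1 h2 => a b *; rewrite /= cexpD.
set c := cexp (Re w) _.
have -> : c * cexp s t - c - (s +i* t : C) * c = c * (cexp s t - 1 - (s +i* t)).
  by ring.
rewrite rnormM rnorm_cexp -/m.
have := @cexp_quadratic s t (le_trans (Re_le_rnorm _) h1) (le_trans (Im_le_rnorm _) h1).
move: h2; set x := rnorm _ => h2 h3.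
rewrite -[leLHS]/(m * _).
apply: le_trans (ler_wpM2l (ltW m0) h3) _.
rewrite expr2 !mulrA ler_wpM2r ?rnorm_ge0 //.
by move: h2; rewrite ler_pdivlMr ?mulr_gt0 //; lra.
Qed.

End cexp.

Section mean_value.
Variable R : realType.
Notation C := (R[i]^o).
Notation Re := complex.Re.
Notation Im := complex.Im.

Lemma eps_continuous (h : R -> R) :
  (forall x e : R, 0 < e -> exists2 d : R, 0 < d & forall y, `|y - x| <= d ->
    `|h y - h x| <= e) -> continuous h.
Proof.
move=> hc x; apply/cvgrPdist_le => e e0; have [d d0 hd] := hc x e e0.
apply/nbhs_normP; exists d => //= y; rewrite distrC => xy.
by apply: hd; rewrite distrC; exact: ltW.
Qed.

Variables (f : C -> C) (z0 : C) (rho : R).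
Hypothesis rho0 : 0 < rho.
Hypothesis df : forall z : C, rnorm (z - z0) < rho -> differentiable f z.

Let G (w : C) : C := f (z0 + cexp (Re w) (Im w)).

Let dG (w : C) : Re w < ln rho -> differentiable G w.
Proof.
move=> wr; have dc := cexp_differentiable w.
apply: (@differentiable_comp _ _ _ _ (fun w : C => z0 + cexp (Re w) (Im w) : C) f).
  by apply: differentiableD => //; exact: dc.
by apply: df; rewrite addrAC subrr add0r rnorm_cexp -[ltRHS](lnK rho0) ltr_expR.
Qed.

(* Clamping [s] at [b] makes the integrands continuous on all of R. *)
Let F b s t : C := G (Num.min s b +i* t).

Let rnorm_ReIm (a b : R) : rnorm (a +i* b : C) <= `|a| + `|b|.
Proof. exact: (rnorm_le_ReIm (a +i* b)). Qed.

Let F_continuous b : b < ln rho ->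
  [/\ forall s, continuous (fun t => Re (F b s t)),
      forall t, continuous (fun s => Re (F b s t)),
      forall s, continuous (fun t => Im (F b s t)) &
      forall t, continuous (fun s => Im (F b s t))].
Proof.
move=> br.
have loc (s t : R) : exists2 K : R, 0 < K & exists2 d : R, 0 < d &
    forall s' t' : R, `|s' - s| + `|t' - t| <= d ->
    rnorm (F b s' t' - F b s t) <= K * (`|s' - s| + `|t' - t|).
  have [|K K0 [d d0 H]] := @differentiable_lipschitz _ _ _ G (Num.min s b +i* t).
    by apply: dG => /=; apply: le_lt_trans br; rewrite ge_min lexx orbT.
  exists K => //; exists d => // s' t' st'.
  pose h : C := (Num.min s' b - Num.min s b) +i* (t' - t).
  have hst : rnorm h <= `|s' - s| + `|t' - t|.
    apply: le_trans (rnorm_ReIm _ _) _; rewrite lerD2r /Num.min.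
    by do 2!case: ltP => ?; rewrite ler_norml; case: (ger0P (s' - s)) => ?;
      apply/andP; split; lra.
  have -> : F b s' t' = G ((Num.min s b +i* t : C) + h).
    by rewrite /F; congr G; apply/eqP; rewrite eq_complex /=;
       apply/andP; split; apply/eqP; ring.
  apply: le_trans (H _ (le_trans hst st')) _.
  by rewrite ler_wpM2l // ltW.
have con (phi : C -> R) : (forall z w : C, `|phi z - phi w| <= rnorm (z - w)) ->
  (forall s, continuous (fun t => phi (F b s t))) /\
  (forall t, continuous (fun s => phi (F b s t))).
  move=> phiP; split=> [s|t]; apply: eps_continuous => x e e0.
    have [K K0 [d d0 H]] := loc s x; exists (Num.min d (e / K)).
      by rewrite lt_min d0 divr_gt0.
    move=> y; rewrite le_min ler_pdivlMr // => /andP[y1 y2].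
    apply: le_trans (phiP _ _) _; apply: le_trans (H _ _ _) _.
      by rewrite subrr normr0 add0r.
    by rewrite subrr normr0 add0r mulrC.
  have [K K0 [d d0 H]] := loc x t; exists (Num.min d (e / K)).
    by rewrite lt_min d0 divr_gt0.
  move=> y; rewrite le_min ler_pdivlMr // => /andP[y1 y2].
  apply: le_trans (phiP _ _) _; apply: le_trans (H _ _ _) _.
    by rewrite subrr normr0 addr0.
  by rewrite subrr normr0 addr0 mulrC.
have [] := con (@complex.Re R); first by move=> z w; rewrite -raddfB; exact: Re_le_rnorm.
have [] := con (@complex.Im R); first by move=> z w; rewrite -raddfB; exact: Im_le_rnorm.
by split.
Qed.

(** With w = s + i t, the form is the imaginary part of G dw, and by Cauchy-Riemann both cross
    derivatives are the real part of G'. On vertical sides it restricts to [Re G dt], the integrand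
    of the circle mean. *)
Let F_closed b s t : b < ln rho -> s < b ->
  closed_at (fun s t => Im (F b s t)) (fun s t => Re (F b s t)) s t.
Proof.
move=> br sb; pose w : C := s +i* t.
have [|_ H] := @differentiable_eps _ _ _ G w; first exact/dG/(lt_trans sb).
pose l := 'd G w (1 : C); exists (Im l), (Re l), (- Im l) => e e0; have [d d0 Hd] := H e e0.
exists (Num.min (d / 2) (b - s)); first by rewrite lt_min divr_gt0 //= subr_gt0.
move=> s' t'; rewrite !le_min => /andP[s1 s2] /andP[t1 _].
have s'b : s' <= b by have := ler_norm (s' - s); lra.
pose h : C := (s' - s) +i* (t' - t).
have Fw : F b s t = G w by rewrite /F min_l // ltW.
have Fwh : F b s' t' = G (w + h).
  rewrite /F min_l //; congr G; apply/eqP; rewrite eq_complex /=.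
  by apply/andP; split; apply/eqP; ring.
have hst : rnorm h <= `|s' - s| + `|t' - t| by exact: rnorm_ReIm.
have := Hd h; rewrite diff_complex -/l -Fw -Fwh => {}Hd.
have {}Hd : rnorm (F b s' t' - F b s t - h * l : C) <= e * (`|s' - s| + `|t' - t|).
  apply: le_trans (Hd _) _; first by apply: le_trans hst _; lra.
  by rewrite ler_wpM2l // ltW.
have ImE (u v k m : C) :
    Im u - (Im v + Im m * Re k + Re m * Im k) = Im (u - v - k * m).
  by case: u v k m => [? ?] [? ?] [? ?] [? ?] /=; ring.
have ReE (u v k m : C) :
    Re u - (Re v + Re m * Re k + - Im m * Im k) = Re (u - v - k * m).
  by case: u v k m => [? ?] [? ?] [? ?] [? ?] /=; ring.
split; [rewrite (ImE _ _ h)|rewrite (ReE _ _ h)]; apply: le_trans Hd.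
  exact: Im_le_rnorm.
exact: Re_le_rnorm.
Qed.

(* Goursat's theorem for w |-> f (z0 + exp w) on a square of side 2 pi: the horizontal
   sides cancel by periodicity, so the means over the circles of radii e^s and
   e^(s - 2 pi) agree; iterating, the radius tends to 0. *)
Lemma circle_mean_value (s1 : R) : expR s1 < rho ->
  exists2 Q : R -> R,
    forall t, 0 <= t <= 2 * pi -> is_derive t 1 Q (Re (f (z0 + cexp s1 t))) &
    Q (2 * pi) - Q 0 = 2 * pi * Re (f z0).
Proof.
move=> s1rho; have s1r : s1 < ln rho by rewrite -ltr_expR lnK.
pose b := (s1 + ln rho) / 2.
have sb : s1 < b by rewrite /b; lra.
have br : b < ln rho by rewrite /b; lra.
have [cq _ _ cp] := F_continuous br.
have pi0 := pi_gt0 R.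
have FE s t : s <= b -> F b s t = f (z0 + cexp s t) by move=> h; rewrite /F min_l.
have /choice[Fq dFq] : forall s, exists Q : R -> R, forall t : R,
    0 <= t <= 2 * pi -> is_derive t 1 Q (Re (F b s t)).
  move=> s.
  have [Q dQ] := continuous_primitive (2 * pi + 1) (cq s).
  by exists Q => t /andP[t0 t1]; apply: dQ; rewrite ger0_norm //; lra.
(* For s <= b, the integral of [Re f] in the angle over the circle of radius e^s about [z0]. *)
pose inc s := Fq s (2 * pi) - Fq s 0.
have incS s : s <= s1 -> inc s = inc (s - 2 * pi).
  move=> ss1; pose a := s - 2 * pi.
  have /choice[Fp dFp] : forall t, exists Q : R -> R, forall x : R,
      a <= x <= s -> is_derive x 1 Q (Im (F b x t)).
    move=> t.
    have [Q dQ] := continuous_primitive (`|a| + `|s| + 1) (cp t).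
    exists Q => x /andP[ax xs]; apply: dQ.
    have := ler_norm s; have := ler_norm (- a); have := normr_ge0 a.
    have := normr_ge0 s; rewrite normrN ltr_norml => *; apply/andP; split; lra.
  have E := @goursat_square R (fun s t => Im (F b s t)) (fun s t => Re (F b s t))
    (fun x t => Fp t x) Fq a 0 (2 * pi).
  have as_ : a + 2 * pi = s by rewrite /a; ring.
  have E2 : Fp (2 * pi) s - Fp (2 * pi) a = Fp 0 s - Fp 0 a.
    apply/eqP; rewrite -subr_eq0 -normr_le0.
    have := @increment_close R (Fp (2 * pi)) (Fp 0) (fun x => Im (F b x (2 * pi)))
      (fun x => Im (F b x 0)) a s 0.
    rewrite mul0r => H; apply: (H _ (dFp (2 * pi)) (dFp 0)).
      by rewrite /a; lra.
    move=> x /andP[_ xs]; have xb : x <= b by lra.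
    by rewrite !FE // cexp_periodic subrr normr0.
  move: E; rewrite as_ add0r E2 => E.
  have {}E : Fp 0 s - Fp 0 a + (Fq s (2 * pi) - Fq s 0)
      - (Fp 0 s - Fp 0 a) - (Fq a (2 * pi) - Fq a 0) = 0.
    apply: (E _ (fun x t xa _ => dFp t x xa) (fun x t _ => dFq x t)).
      by rewrite mulr_gt0.
    by move=> x t /andP[_ xs] _; apply: F_closed => //; lra.
  by rewrite /inc -/a; lra.
have incn n : inc s1 = inc (s1 - n%:R * (2 * pi)).
  elim: n => [|n ->]; first by rewrite mul0r subr0.
  rewrite incS; last by rewrite lerBlDr lerDl mulr_ge0 //; lra.
  by congr inc; rewrite -natr1; ring.
exists (Fq s1); first by move=> t tc; rewrite -FE ?(ltW sb) //; exact: dFq.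
rewrite -/(inc s1); apply/eqP; rewrite -subr_eq0 -normr_le0.
apply/ler_addgt0Pr => e e0; rewrite add0r.
have [|K K0 [d d0 Kd]] := @differentiable_lipschitz _ _ _ f z0.
  by apply: df; rewrite subrr rnorm0.
(* On a circle of radius at most [k] the integrand differs from [Re (f z0)] by at most [K * k],
   which over the length 2 pi costs at most [e]. *)
pose k := Num.min d (e / (K * (2 * pi))).
have k0 : 0 < k by rewrite lt_min d0 divr_gt0 // !mulr_gt0.
have [n sn] : exists n, expR (s1 - n%:R * (2 * pi)) <= k.
  exists (Num.truncn (expR s1 / k)).+1; set n := _.+1.
  have nk : expR s1 / k < n%:R by rewrite truncnS_gt.
  rewrite expRD expRN ler_pdivrMr ?expR_gt0 //.
  rewrite ltr_pdivrMr // in nk; apply: le_trans (ltW nk) _.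
  rewrite mulrC ler_wpM2l ?(ltW k0) //.
  apply: le_trans (expR_ge1Dx _); rewrite -[leLHS]mulr1.
  have := pi_ge2 R => p2.
  have : (n%:R : R) * 1 <= n%:R * (2 * pi) by rewrite ler_wpM2l //; lra.
  by lra.
rewrite (incn n); set s := s1 - _ in sn *.
have ss1 : s <= s1 by rewrite /s lerBlDr lerDl mulr_ge0 //; lra.
have := @increment_close R (Fq s) (fun t => Re (f z0) * t)
  (fun t => Re (F b s t)) (fun=> Re (f z0)) 0 (2 * pi) (K * k).
rewrite mulr0 !subr0 [Re (f z0) * _]mulrC => H.
apply: le_trans (H _ (dFq s) _ _) _.
- by lra.
- by move=> t _; apply: is_derive_eq; rewrite [LHS]mulr1.
- move=> t _; rewrite FE; last by lra.
  rewrite -raddfB; apply: le_trans (Re_le_rnorm _) _.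
  apply: le_trans (Kd _ _) _.
    by rewrite rnorm_cexp (le_trans sn) // ge_min lexx.
  by rewrite rnorm_cexp ler_wpM2l // ltW.
rewrite -mulrA [k * _]mulrC mulrA mulrC -ler_pdivlMr ?mulr_gt0 //.
by rewrite ge_min lexx orbT.
Qed.

End mean_value.

Section max_principle.
Variable R : realType.
Notation C := (R[i]^o).
Notation Re := complex.Re.
Notation Im := complex.Im.

Lemma disk_compact (r : R) : compact [set p : R * R | p.1 ^+ 2 + p.2 ^+ 2 <= r ^+ 2].
Proof.
have c12 : continuous (fun p : R * R => p.1 ^+ 2 + p.2 ^+ 2).
  move=> p; apply: cvgD.
    by apply: (@continuous_comp _ _ _ fst (fun x : R => x ^+ 2));
      [exact: cvg_fst|exact: exprn_continuous].
  by apply: (@continuous_comp _ _ _ snd (fun x : R => x ^+ 2));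
    [exact: cvg_snd|exact: exprn_continuous].
apply: (@subclosed_compact _ _ (`[- `|r|, `|r|] `*` `[- `|r|, `|r|])).
- rewrite (_ : [set p | _] =
     (fun p : R * R => p.1 ^+ 2 + p.2 ^+ 2) @^-1` `]-oo, r ^+ 2]); last first.
    by apply/seteqP; split => p /=; rewrite in_itv.
  by apply: closed_comp => // p _; exact: c12.
- by apply: compact_setX; exact: segment_compact.
- have sub (x y : R) : x ^+ 2 + y ^+ 2 <= r ^+ 2 -> `|x| <= `|r|.
    move=> xy; rewrite -ler_sqr ?nnegrE // !real_normK ?num_real //.
    by have := sqr_ge0 y; lra.
  move=> [x y] /= xy; rewrite !in_itv /= -!ler_norml; split; first exact: sub xy.
  by apply: (sub y x); rewrite addrC.
Qed.

(* If |f z| + e |z|^2 had an interior maximum, the mean value property on a small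
   circle around it would be violated. Differentiability is not required at 0, where
   [f] vanishes. *)
Lemma max_principle (f : C -> C) (r M : R) : 0 < r -> 0 <= M -> f 0 = 0 ->
  (forall z : C, 0 < rnorm z < r -> differentiable f z) ->
  (forall z : C, rnorm z <= r -> forall e : R, 0 < e -> exists2 d : R, 0 < d &
     forall h : C, rnorm h <= d -> rnorm (f (z + h) - f z) <= e) ->
  (forall z : C, rnorm z = r -> rnorm (f z) <= M) ->
  forall z : C, rnorm z <= r -> rnorm (f z) <= M.
Proof.
move=> r0 M0 f0 df cf fM z zr; apply/ler_addgt0Pr => e' e'0.
pose e := e' / r ^+ 2; have e0 : 0 < e by rewrite divr_gt0 // exprn_gt0.
have -> : e' = e * r ^+ 2 by rewrite /e divfK // expf_neq0 // gt_eqF.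
pose K := [set p : R * R | p.1 ^+ 2 + p.2 ^+ 2 <= r ^+ 2].
pose g (p : R * R) : R := rnorm (f (p.1 +i* p.2)).
pose n2 (p : R * R) : R := e * (p.1 ^+ 2 + p.2 ^+ 2).
have KE (x y : R) : (x, y) \in K = (rnorm (x +i* y : C) <= r).
  rewrite -ler_sqr ?nnegrE ?rnorm_ge0 ?(ltW r0) // rnorm_sqr /=.
  by apply/idP/idP; rewrite inE.
have cg : {within K, continuous (fun p => g p + n2 p)}.
  apply: continuous_in_subspaceT => -[x y]; rewrite KE => xy.
  apply: cvgD.
    apply/cvgrPdist_le => d d0.
    have [k k0 Hk] := cf (x +i* y) xy d d0.
    have k2 : 0 < k / 2 by rewrite divr_gt0.
    exists (ball x (k / 2), ball y (k / 2)).
      by split; apply: nbhsx_ballx.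
    move=> [x' y'] [/= xx' yy']; rewrite /ball /= in xx' yy'.
    pose h : C := (x' - x) +i* (y' - y).
    have hk : rnorm h <= k.
      apply: le_trans (rnorm_le_ReIm _) _; rewrite /= distrC [`|y' - y|]distrC.
      by lra.
    have := Hk h hk; rewrite /g /=.
    have -> : (x +i* y : C) + h = x' +i* y'.
      by apply/eqP; rewrite eq_complex /=; apply/andP; split; apply/eqP; ring.
    apply: le_trans; rewrite distrC ler_norml; apply/andP; split.
      have := rnormD (f (x +i* y) - f (x' +i* y')) (f (x' +i* y')).
      by rewrite subrK rnormC; lra.
    have := rnormD (f (x' +i* y') - f (x +i* y)) (f (x +i* y)).
    by rewrite subrK; lra.
  apply: cvgM; first exact: cvg_cst.
  apply: cvgD.
    by apply: (@continuous_comp _ _ _ fst (fun x : R => x ^+ 2));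
      [exact: cvg_fst|exact: exprn_continuous].
  by apply: (@continuous_comp _ _ _ snd (fun x : R => x ^+ 2));
    [exact: cvg_snd|exact: exprn_continuous].
have [|[x0 y0] cK maxc] := compact_EVT_max _ (@disk_compact r) cg.
  by exists (0, 0); rewrite /= expr0n addr0 sqr_ge0.
have {}maxc (w : C) : rnorm w <= r ->
    rnorm (f w) + e * rnorm w ^+ 2 <= g (x0, y0) + n2 (x0, y0).
  case: w => x y wr; have := maxc (x, y); rewrite KE => /(_ wr).
  by rewrite rnorm_sqr.
pose c : C := x0 +i* y0.
have cr : rnorm c <= r by rewrite -KE.
have n2E : n2 (x0, y0) = e * rnorm c ^+ 2 by rewrite rnorm_sqr.
rewrite n2E {n2E} -[g _]/(rnorm (f c)) in maxc.
suff : rnorm (f c) + e * rnorm c ^+ 2 <= M + e * r ^+ 2.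
  apply: le_trans; apply: le_trans (maxc z zr).
  by rewrite lerDl mulr_ge0 ?(ltW e0) // sqr_ge0.
have r2 : rnorm c ^+ 2 <= r ^+ 2 by rewrite lerXn2r ?nnegrE ?rnorm_ge0 // ltW.
have er2 : e * rnorm c ^+ 2 <= e * r ^+ 2 by rewrite ler_wpM2l // ltW.
have [c0|c0] := eqVneq (rnorm c) 0.
  rewrite (rnorm0_eq0 c0) f0 !rnorm0 expr0n mulr0 addr0 addr_ge0 //.
  by rewrite mulr_ge0 ?sqr_ge0 // ltW.
have [rc|rc] := leP r (rnorm c).
  by rewrite lerD // fM //; apply/eqP; rewrite eq_le cr.
exfalso.
have c0' : 0 < rnorm c by rewrite lt_neqAle eq_sym c0 rnorm_ge0.
(* The open disc of radius d about c stays inside the disc of radius r and misses 0, where [f] may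
   fail to be differentiable. *)
pose d := Num.min (r - rnorm c) (rnorm c).
have d0 : 0 < d by rewrite lt_min subr_gt0 rc.
(* [u] rotates [f c] to the nonnegative real axis. *)
pose u : C := (f c)^*%C / (rnorm (f c))%:C.
have uf : Re (u * f c) = rnorm (f c).
  have [->|fc0] := eqVneq (f c) 0; first by rewrite mulr0 rnorm0.
  have nz : rnorm (f c) != 0 by apply: contra_neq fc0; exact: rnorm0_eq0.
  have -> : u * f c = ((rnorm (f c) ^+ 2)%:C / (rnorm (f c))%:C : C).
    rewrite /u mulrAC; congr (_ / _); rewrite mulrC -sqr_normc rmorphXn /=.
    by rewrite rnormE.
  by rewrite -fmorphV -rmorphM /= expr2 mulfK.
have u1 : rnorm u <= 1.
  rewrite /u rnormM rnormV rnorm_real ger0_norm ?rnorm_ge0 //.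
  have -> : rnorm ((f c)^*%C : C) = rnorm (f c).
    by apply: complexI; rewrite !rnormE normcJ.
  have [->|fc0] := eqVneq (rnorm (f c)) 0; first by rewrite mul0r.
  by rewrite divff.
have [||Q dQ QE] := @circle_mean_value R (fun w => u * f w) c d d0 _ (ln (d / 2)).
- move=> w wd; apply: (@differentiableZ _ _ _ f u); apply: df.
  move: wd; rewrite lt_min => /andP[w1 w2].
  have n1 := rnormD (w - c) c; rewrite subrK in n1.
  have n2' := rnormD (c - w) w; rewrite subrK [rnorm (c - w)]rnormC in n2'.
  by apply/andP; split; lra.
- by rewrite lnK ?posrE ?divr_gt0 // ltr_pdivrMr // ltr_pMr // ltrDl.
have dE : expR (ln (d / 2)) = d / 2 by rewrite lnK // posrE divr_gt0.
pose s := ln (d / 2).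
have pi0 := pi_gt0 R.
pose m := rnorm (f c) + e * rnorm c ^+ 2.
(* By maximality the derivative [T'] bounds [Re (u * f)] on the circle of radius d / 2. The sine and
   cosine terms are periodic, so over a full turn [T] grows by 2 pi (|f c| - e (d / 2)^2), less than
   the 2 pi |f c| dictated by the mean value property. *)
pose T (t : R) := (m - e * (rnorm c ^+ 2 + (d / 2) ^+ 2)) * t
  - e * d * (x0 * sin t - y0 * cos t).
pose T' (t : R) := m - e * rnorm (c + cexp s t) ^+ 2.
have dT (t : R) : is_derive t 1 T (T' t).
  have -> : T' t = (m - e * (rnorm c ^+ 2 + (d / 2) ^+ 2))
     - e * d * (x0 * cos t + y0 * sin t).
    rewrite /T' !rnorm_sqr /= dE.
    have := cos2Dsin2 t; move: (cos t) (sin t) => co si cs.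
    have -> : d / 2 = d / 2 * 1 by rewrite mulr1.
    have -> : (d / 2 * 1) ^+ 2 = (d / 2) ^+ 2 * (co ^+ 2 + si ^+ 2).
      by rewrite cs; ring.
    by rewrite !mulr1; field.
  rewrite /T; apply: is_derive_eq; rewrite /GRing.scale /=; ring.
have incr : Q (2 * pi) - Q 0 <= T (2 * pi) - T 0.
  have dQT (t : R) : 0 <= t <= 2 * pi ->
      is_derive t 1 (Q \- T) (Re (u * f (c + cexp s t)) - T' t).
    by move=> tc; have dQt := dQ t tc; have dTt := dT t; exact: is_deriveB.
  have pi20 : 0 <= 2 * pi :> R by rewrite mulr_ge0 // ltW.
  have dQT' t : t \in `]0, 2 * pi[ ->
      is_derive t 1 (Q \- T) (Re (u * f (c + cexp s t)) - T' t).
    by rewrite in_itv /= => /andP[t1 t2]; apply: dQT; rewrite !ltW.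
  have [|t tc E] := MVT_segment pi20 dQT'.
    apply: derivable_within_continuous => t; rewrite in_itv /= => /dQT[].
    by [].

  move: E; rewrite /= subr0 => E; rewrite -subr_le0.
  have -> : Q (2 * pi) - Q 0 - (T (2 * pi) - T 0) =
     Q (2 * pi) - T (2 * pi) - (Q 0 - T 0) by ring.
  rewrite E pmulr_lle0 ?mulr_gt0 // subr_le0 /T'.
  have wr : rnorm (c + cexp s t) <= r.
    apply: le_trans (rnormD _ _) _; rewrite rnorm_cexp dE.
    have : d <= r - rnorm c by rewrite ge_min lexx.
    by lra.
  have := maxc _ wr; rewrite -/m; have := Re_le_rnorm (u * f (c + cexp s t)).
  have := ler_norm (Re (u * f (c + cexp s t))).
  have : rnorm (u * f (c + cexp s t)) <= rnorm (f (c + cexp s t)).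
    by rewrite rnormM -[leRHS]mul1r ler_wpM2r ?rnorm_ge0.
  by lra.
move: incr; rewrite QE uf /T.
have -> : 2 * pi = 0 + pi *+ 2 :> R by rewrite add0r mulr2n; ring.
rewrite cosD2pi sinD2pi add0r leNgt => /negP; apply.
rewrite /m -subr_gt0.
rewrite [ltRHS](_ : _ = pi *+ 2 * (e * (d / 2) ^+ 2)); last first.
  by rewrite mulr2n; ring.
have d2 : 0 < d / 2 by rewrite divr_gt0.
by apply: mulr_gt0; [rewrite mulr2n addr_gt0|rewrite mulr_gt0 // exprn_gt0].
Qed.

End max_principle.

(** * The Schwarz lemma and Taylor estimates *)

Section schwarz.
Variable R : realType.
Notation C := (R[i]^o).
Notation Re := complex.Re.
Notation Im := complex.Im.

(** The constants [A] and [B] disappear in the n-th root; Bernoulli's inequality for x / y does the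
    work of the root. *)
Lemma le_of_powers (x y A B : R) : 0 <= x -> 0 <= y -> 0 < A ->
  (forall n, x ^+ n * A <= y ^+ n * B) -> x <= y.
Proof.
move=> x0 y0 A0 H; rewrite leNgt; apply/negP => yx.
have xp : 0 < x by exact: le_lt_trans yx.
have [y00|yn0] := eqVneq y 0.
  by have := H 1%N; rewrite y00 !expr1 mul0r leNgt mulr_gt0.
have yp : 0 < y by rewrite lt_neqAle eq_sym yn0.
pose t := x / y - 1.
have t0 : 0 < t by rewrite subr_gt0 ltr_pdivlMr // mul1r.
have bern n : 1 + n%:R * t <= (x / y) ^+ n.
  elim: n => [|n IH]; first by rewrite mul0r addr0.
  have qE : x / y = 1 + t by rewrite /t; ring.
  have q0 : 0 <= x / y by rewrite qE; lra.
  rewrite exprSr; apply: le_trans (ler_wpM2r q0 IH); rewrite qE -natr1 -subr_ge0.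
  have -> : (1 + n%:R * t) * (1 + t) - (1 + (n%:R + 1) * t) = n%:R * (t * t) by ring.
  by rewrite !mulr_ge0 // ltW.
have {}H n : (1 + n%:R * t) * A <= B.
  have yn : 0 < y ^+ n by rewrite exprn_gt0.
  apply: le_trans (ler_wpM2r (ltW A0) (bern n)) _.
  rewrite expr_div_n mulrAC ler_pdivrMr // [B * _]mulrC; exact: H.
have := H (Num.truncn (B / (A * t))).+1; set n := _.+1.
have nB : B / (A * t) < n%:R by rewrite truncnS_gt.
rewrite leNgt => /negP; apply.
move: nB; rewrite ltr_pdivrMr ?mulr_gt0 // => nB.
have -> : (1 + n%:R * t) * A = A + n%:R * (A * t) by ring.
lra.
Qed.

(* The maximum principle is applied to f (f / z)^n, which extends continuously by 0 at 0
   (unlike f / z, for which a removable singularity theorem would be needed); letting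
   n tend to infinity gives the bound for f / z. *)
Lemma schwarz (f : C -> C) (M : R) :
  (forall z : C, rnorm z < 1 -> differentiable f z) ->
  (forall z : C, rnorm z < 1 -> rnorm (f z) <= M) -> f 0 = 0 ->
  forall z : C, rnorm z < 1 -> rnorm (f z) <= M * rnorm z.
Proof.
move=> df fM f0 z z1.
have M0 : 0 <= M by apply: le_trans (rnorm_ge0 _) (fM z z1).
have [->|fz0] := eqVneq (f z) 0; first by rewrite rnorm0 mulr_ge0 ?rnorm_ge0.
have z0 : z != 0 by apply: contra_neq fz0 => ->.
have nz0 : 0 < rnorm z.
  by rewrite lt_neqAle rnorm_ge0 andbT eq_sym; apply: contra_neq z0; exact: rnorm0_eq0.
have nf0 : 0 < rnorm (f z).
  by rewrite lt_neqAle rnorm_ge0 andbT eq_sym; apply: contra_neq fz0; exact: rnorm0_eq0.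
(* On |w| = r the quotient f / w is at most M / r, and the maximum principle carries this bound
   inside. The loss of 1 / r is removed afterwards by letting r approach 1. *)
have key (r : R) : rnorm z <= r -> r < 1 -> rnorm (f z) * r <= M * rnorm z.
  move=> zr r1; have r0 : 0 < r by exact: lt_le_trans zr.
  apply: (@le_of_powers _ _ (rnorm (f z)) M) => //.
  - by rewrite mulr_ge0 ?rnorm_ge0 // ltW.
  - by rewrite mulr_ge0 ?rnorm_ge0.
  move=> n; pose H (w : C) : C := f w * (f w * w^-1) ^+ n.
  have nH w : rnorm (H w) = rnorm (f w) * (rnorm (f w) / rnorm w) ^+ n.
    by rewrite /H rnormM rnormX rnormM rnormV.
  have dH (w : C) : w != 0 -> rnorm w < 1 -> differentiable H w.
    move=> w0 w1.
    apply: (@differentiableM _ _ f (fun w => (f w * w^-1) ^+ n)); first exact: df.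
    elim: n {H nH} => [|n IH].
      exact: (@differentiable_cst _ _ _ (1 : C)).
    rewrite (_ : (fun w => _) = (fun w : C => f w * w^-1 : C) * (fun w => (f w * w^-1) ^+ n)).
      apply: differentiableM IH.
      apply: (@differentiableM _ _ f (fun w => w^-1)); first exact: df.
      exact: differentiable_Rinv.
    by apply/funext => v; rewrite exprS.
  have := @max_principle R H r (M * (M / r) ^+ n) r0.
  have -> : H 0 = 0 by rewrite /H f0 mul0r.
  move=> /(_ _ erefl) mp.
  have : rnorm (H z) <= M * (M / r) ^+ n.
    apply: mp; last exact: zr.
    - by rewrite mulr_ge0 // exprn_ge0 // divr_ge0 // ltW.
    - move=> w /andP[w0 wr]; apply: dH; last exact: lt_trans wr r1.
      by apply: contraTneq w0 => ->; rewrite rnorm0 ltxx.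
    - move=> w wr e e0; have w1 : rnorm w < 1 by exact: le_lt_trans r1.
      have [->|w0] := eqVneq w 0.
        have [|K K0 [d d0 Kd]] := @differentiable_lipschitz _ _ _ f 0.
          by apply: df; rewrite rnorm0.
        exists (Num.min d (e / (K * K ^+ n))).
          by rewrite lt_min d0 divr_gt0 // mulr_gt0 // exprn_gt0.
        move=> h; rewrite le_min ler_pdivlMr ?mulr_gt0 ?exprn_gt0 //.
        move=> /andP[h1 h2].
        have := Kd h h1; rewrite add0r f0 !subr0 => fh.
        rewrite /H f0 mul0r subr0 -/(H h) nH; apply: le_trans h2.
        rewrite mulrA [rnorm h * K]mulrC.
        have hK : rnorm (f h) / rnorm h <= K.
          have [->|h0] := eqVneq (rnorm h) 0; first by rewrite invr0 mulr0 ltW.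
          by rewrite ler_pdivrMr // lt_neqAle eq_sym h0 rnorm_ge0.
        have q0 : 0 <= rnorm (f h) / rnorm h by rewrite divr_ge0 ?rnorm_ge0.
        by rewrite ler_pM ?rnorm_ge0 ?exprn_ge0 // lerXn2r ?nnegrE // ltW.
      have [K K0 [d d0 Kd]] := differentiable_lipschitz (dH w w0 w1).
      exists (Num.min d (e / K)); first by rewrite lt_min d0 divr_gt0.
      move=> h; rewrite le_min ler_pdivlMr // => /andP[h1 h2].
      by apply: le_trans (Kd h h1) _; rewrite mulrC.
    - move=> w wr; have w1 : rnorm w < 1 by rewrite wr.
      have q0 : 0 <= rnorm (f w) / rnorm w by rewrite divr_ge0 ?rnorm_ge0.
      rewrite nH wr ler_pM ?exprn_ge0 ?rnorm_ge0 ?fM // -?wr //.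
      rewrite lerXn2r ?nnegrE // ?divr_ge0 ?rnorm_ge0 //.
      by rewrite ler_wpM2r ?invr_ge0 ?rnorm_ge0 ?fM.
  rewrite nH !expr_div_n => h1.
  have rn : 0 < r ^+ n by rewrite exprn_gt0.
  have zn : 0 < rnorm z ^+ n by rewrite exprn_gt0.
  move: h1; rewrite mulrA mulrA ler_pdivrMr // mulrAC ler_pdivlMr // => h1.
  rewrite !exprMn.
  have -> : rnorm (f z) ^+ n * r ^+ n * rnorm (f z) =
    rnorm (f z) * rnorm (f z) ^+ n * r ^+ n by ring.
  by have -> : M ^+ n * rnorm z ^+ n * M = M * M ^+ n * rnorm z ^+ n by ring.
rewrite leNgt; apply/negP => lt.
pose a := rnorm (f z); pose b := M * rnorm z.
(* If a > b, then (a + b) / (2 a) is the number below 1 whose product with a is the midpoint of a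
   and b, which [key] forbids. The maximum only ensures |z| <= r. *)
pose r := Num.max (rnorm z) ((a + b) / (2 * a)).
have a0 : 0 < a by [].
have b0 : 0 <= b by rewrite mulr_ge0 ?rnorm_ge0.
have ab : b < a by [].
have r1 : r < 1.
  by rewrite gt_max z1 /= ltr_pdivrMr ?mulr_gt0 //; lra.
have zr : rnorm z <= r by rewrite le_max lexx.
have := key r zr r1; rewrite -/a -/b.
have : a * ((a + b) / (2 * a)) <= a * r.
  by rewrite ler_wpM2l ?(ltW a0) // le_max lexx orbT.
have -> : a * ((a + b) / (2 * a)) = (a + b) / 2 by field; rewrite gt_eqF.
by lra.
Qed.

Lemma affine_differentiable (a b w : C) : differentiable (fun w : C => a * w + b : C) w.
Proof.
apply: (@eps_complex_differentiable _ _ _ a) => e e0; exists 1 => // h _.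
have -> : a * (w + h) + b - (a * w + b) - h * a = 0 :> C by ring.
by rewrite rnorm0 mulr_ge0 ?rnorm_ge0 // ltW.
Qed.

(* Both estimates come from the Schwarz lemma: applied to t |-> f (z + t) - f z it
   bounds increments, applied to z |-> f (z + t) - f z it bounds second increments,
   and those are summed along z, z/2, z/4, ... *)
Lemma taylor1 (f : C -> C) (M : R) :
  (forall z : C, rnorm z < 1 -> differentiable f z) ->
  (forall z : C, rnorm z < 1 -> rnorm (f z) <= M) ->
  forall z : C, rnorm z < 1 ->
    rnorm (f z - f 0) <= 2 * M * rnorm z /\
    rnorm (f z - f 0 - 'd f 0 z) <= 8 * M * rnorm z ^+ 2.
Proof.
move=> df fM.
have M0 : 0 <= M by apply: le_trans (rnorm_ge0 _) (fM 0 _); rewrite rnorm0.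
have first z : rnorm z < 1 -> rnorm (f z - f 0) <= 2 * M * rnorm z.
  move=> z1; apply: (@schwarz (fun z => f z - f 0)); last exact: z1.
  - by move=> w w1; apply: differentiableB; [exact: df|exact: differentiable_cst].
  - move=> w w1; apply: le_trans (rnormD _ _) _; rewrite rnormN.
    have := fM _ w1; have := fM 0; rewrite rnorm0 => /(_ ltr01); lra.
  - by rewrite subrr.
have E2 (w : C) : 2^-1 * (2 * w) = w by rewrite mulrA mulVf ?mul1r // pnatr_eq0.
(* For a base point in the half disc, rescaling t by 2 fills the unit disc, so the bound 2 M on the
   increment becomes the slope 4 M. *)
have half (z t : C) : rnorm z < 1 / 2 -> rnorm t < 1 / 2 ->
    rnorm (f (z + t) - f z) <= 4 * M * rnorm t.
  move=> z1 t1.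
  have := @schwarz (fun t => f (2^-1 * t + z) - f z) (2 * M) _ _ _ (2 * t).
  have n2 : rnorm (2 : C) = 2 by rewrite /rnorm normr_nat /= .
  have n12 (w : C) : rnorm (2^-1 * w : C) = rnorm w / 2.
    by rewrite rnormM rnormV n2 mulrC.
  have lt1 (w : C) : rnorm w < 1 -> rnorm (2^-1 * w + z) < 1.
    by move=> w1; apply: le_lt_trans (rnormD _ _) _; rewrite n12; lra.
  have zlt : rnorm z < 1 by lra.
  rewrite E2 [t + z]addrC rnormM n2 => H.
  have -> : 4 * M * rnorm t = 2 * M * (2 * rnorm t) by ring.
  apply: H.
  - move=> w w1; apply: differentiableB; last exact: differentiable_cst.
    apply: (@differentiable_comp _ _ _ _ (fun w : C => 2^-1 * w + z : C) f).
      exact: affine_differentiable.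
    exact/df/lt1.
  - move=> w w1; apply: le_trans (rnormD _ _) _; rewrite rnormN.
    by have := fM _ (lt1 w w1); have := fM _ zlt; lra.
  - by rewrite mulr0 add0r subrr.
  - by lra.
(* By [half] the difference of two increments is at most 8 M |z|. The Schwarz lemma in the base
   point, again rescaled by 2, contributes the second factor |z| and the constant 16. *)
have second z : rnorm z < 1 / 2 ->
    rnorm (f (z + z) - f z - (f z - f 0)) <= 16 * M * rnorm z ^+ 2.
  move=> z1.
  have := @schwarz (fun w => f (2^-1 * w + z) - f (2^-1 * w + 0) - (f z - f 0))
    (8 * M * rnorm z) _ _ _ (2 * z).
  have n2 : rnorm (2 : C) = 2 by rewrite /rnorm normr_nat /= .
  have n12 (w : C) : rnorm (2^-1 * w : C) = rnorm w / 2.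
    by rewrite rnormM rnormV n2 mulrC.
  have lt1 (w : C) : rnorm w < 1 -> rnorm (2^-1 * w + z) < 1.
    by move=> w1; apply: le_lt_trans (rnormD _ _) _; rewrite n12; lra.
  have lt2 (w : C) : rnorm w < 1 -> rnorm (2^-1 * w + 0) < 1.
    by move=> w1; rewrite addr0 n12; have := rnorm_ge0 w; lra.
  rewrite E2 (addr0 z) rnormM n2 => H.
  have -> : 16 * M * rnorm z ^+ 2 = 8 * M * rnorm z * (2 * rnorm z) by ring.
  apply: H.
  - move=> w w1.
    apply: differentiableB; last exact: differentiable_cst.
    apply: differentiableB.
      apply: (@differentiable_comp _ _ _ _ (fun w : C => 2^-1 * w + z : C) f).
        exact: affine_differentiable.
      exact/df/lt1.
    apply: (@differentiable_comp _ _ _ _ (fun w : C => 2^-1 * w + 0 : C) f).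
      exact: affine_differentiable.
    exact/df/lt2.
  - move=> w w1; apply: le_trans (rnormD _ _) _; rewrite rnormN.
    have h1 := half (2^-1 * w) z; rewrite n12 in h1.
    have h2 := half 0 z; rewrite rnorm0 add0r in h2.
    have := h1 ltac:(lra) z1; have := h2 ltac:(lra) z1.
    rewrite (addr0 (2^-1 * w)).
    lra.
  - by rewrite mulr0 !add0r subrr.
  - by lra.
move=> z z1; split; first exact: first.
pose phi (w : C) : C := f w - f 0 - 'd f 0 w.
have phi2 w : rnorm w < 1 / 2 ->
    rnorm (phi (w + w)) <= 2 * rnorm (phi w) + 16 * M * rnorm w ^+ 2.
  move=> w1; have := second w w1.
  have -> : f (w + w) - f w - (f w - f 0) = phi (w + w) - (phi w + phi w).
    by rewrite /phi linearD /=; ring.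
  move=> H.
  have := rnormD (phi (w + w) - (phi w + phi w)) (phi w + phi w).
  by rewrite subrK; have := rnormD (phi w) (phi w); lra.
pose zn n : C := (2^-1)%:C ^+ n * z.
have znE n : rnorm (zn n) = rnorm z / 2 ^+ n.
  by rewrite rnormM rnormX rnorm_real ger0_norm ?invr_ge0 // exprVn mulrC.
have znS n : zn n = zn n.+1 + zn n.+1.
  rewrite /zn -mulrDl exprS -mulrDl -rmorphD /=.
  have -> : 2^-1 + 2^-1 = 1 :> R by field.
  by rewrite mul1r.
(* Passing from n to n + 1 costs 2^n * 16 M |z|^2 / 4^(n + 1), a telescoping difference with total
   at most 8 M |z|^2. The leading term tends to 0 because [phi] is o(|w|) at 0. *)
have phin n : rnorm (phi z) <= 2 ^+ n * rnorm (phi (zn n))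
    + 8 * M * rnorm z ^+ 2 * (1 - (2 ^+ n)^-1).
  elim: n => [|n IH].
    by rewrite /zn !expr0 !mul1r invr1 subrr mulr0 addr0.
  apply: le_trans IH _.
  have [p0 pE] : 0 < 2 ^+ n :> R /\ 2 ^+ n.+1 = 2 * 2 ^+ n :> R.
    by rewrite exprn_gt0 // exprS.
  have zn1 : rnorm (zn n.+1) < 1 / 2.
    rewrite znE pE ltr_pdivrMr ?mulr_gt0 // mulrA div1r mulVf // mul1r.
    apply: lt_le_trans z1 _; rewrite -natrX ler1n expn_gt0 //.
  have := phi2 _ zn1; rewrite -znS znE pE => H.
  have {}H := ler_wpM2l (ltW p0) H.
  move: H; rewrite mulrDr => H.
  have E1 : 2 ^+ n * (16 * M * (rnorm z / (2 * 2 ^+ n)) ^+ 2) =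
     8 * M * rnorm z ^+ 2 * ((2 ^+ n)^-1 - (2 * 2 ^+ n)^-1).
    by field; rewrite gt_eqF.
  rewrite E1 in H; lra.
apply/ler_addgt0Pr => e e0.
have [|_ /(_ e e0)[d d0 Hd]] := @differentiable_eps _ _ _ f 0.
  by apply: df; rewrite rnorm0.
pose n := (Num.truncn (d^-1)).+1.
have p0 : 0 < 2 ^+ n :> R by rewrite exprn_gt0.
have nd : d^-1 <= 2 ^+ n.
  apply: le_trans (ltW (truncnS_gt _)) _; rewrite -natrX ler_nat.
  exact/ltnW/ltn_expl.
have znd : rnorm (zn n) <= d.
  rewrite znE ler_pdivrMr //; apply: le_trans (ltW z1) _.
  by rewrite -ler_pdivrMl // mulr1.
have := Hd _ znd; rewrite add0r -/(phi (zn n)) znE => H.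
apply: le_trans (phin n) _; rewrite addrC lerD //.
  rewrite -[leRHS]mulr1; apply: ler_wpM2l.
    by rewrite mulr_ge0 ?sqr_ge0 // mulr_ge0.
  by rewrite lerBlDr lerDl invr_ge0 ltW.
apply: le_trans (ler_wpM2l (ltW p0) H) _.
have -> : 2 ^+ n * (e * (rnorm z / 2 ^+ n)) = e * rnorm z by field; rewrite gt_eqF.
by rewrite -[leRHS]mulr1 ler_wpM2l // ltW.
Qed.

End schwarz.

Section taylor_ball.
Variables (R : realType) (V : normedModType R[i]).
Notation C := (R[i]^o).

Variables (f : V -> C) (M : R) (x : V) (rho : R).
Hypothesis rho0 : 0 < rho.
Hypothesis df : forall y : V, rnorm (y - x) < rho -> differentiable f y.
Hypothesis fM : forall y : V, rnorm (y - x) < rho -> rnorm (f y) <= M.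

(** The one-variable estimate along z |-> x + z u, where [u] is [h] rescaled to length [rho] so that
    the unit disc maps into the ball. *)
Lemma taylor_ball (h : V) : rnorm h < rho ->
  rnorm (f (x + h) - f x) <= 2 * M / rho * rnorm h /\
  rnorm (f (x + h) - f x - 'd f x h) <= 8 * M / rho ^+ 2 * rnorm h ^+ 2.
Proof.
move=> hrho; have [->|h0] := eqVneq h 0.
  by rewrite linear0 addr0 subrr subr0 !rnorm0 expr0n !mulr0.
have nh : 0 < rnorm h.
  by rewrite lt_neqAle rnorm_ge0 andbT eq_sym; apply: contra_neq h0; exact: rnorm0_eq0.
pose u : V := (rho / rnorm h)%:C *: h.
have nu : rnorm u = rho by rewrite rnorm_realZ ger0_norm ?divr_ge0 ?ltW // divfK ?gt_eqF.
pose L (z : C) : V := x + z *: u.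
have LB (z : C) : rnorm z < 1 -> rnorm (L z - x) < rho.
  by move=> z1; rewrite /L addrAC subrr add0r rnormZ nu -[ltRHS]mul1r ltr_pM2r.
have L0 : L 0 = x by rewrite /L scale0r addr0.
have dx : differentiable f (L 0) by rewrite L0; apply: df; rewrite subrr rnorm0.
have iL (z : C) : is_diff z L (fun w : C => w *: u).
  have iZ : is_diff z (fun w : C => w *: u) (fun w : C => w *: u).
    apply: DiffDef; first exact: (@differentiableZl _ _ _ id).
    by rewrite (@diffZl _ _ _ id) // diff_val.
  by have := @is_diffD _ _ _ (cst x) _ 0 _ z _ iZ; rewrite add0r; apply.
pose F (z : C) : C := f (L z).
have dF (z : C) : rnorm z < 1 -> differentiable F z.
  move=> z1; apply: (@differentiable_comp _ _ _ _ L f); first exact: ex_diff.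
  exact/df/LB.
have F' (z : C) : 'd F 0 z = 'd f x (z *: u).
  by rewrite (@diff_comp _ _ _ _ L f) //= L0 diff_val.
pose t := rnorm h / rho.
have tu : (t%:C : R[i]) *: u = h.
  rewrite /u scalerA -rmorphM /t mulrA divfK ?gt_eqF // divff ?gt_eqF //.
  by rewrite scale1r.
have nt : rnorm (t%:C : C) = t by rewrite rnorm_real ger0_norm // divr_ge0 // ltW.
have t1 : rnorm (t%:C : C) < 1 by rewrite nt ltr_pdivrMr // mul1r.
have [|H1 H2] := @taylor1 R F M dF _ t%:C t1; first by move=> z z1; exact/fM/LB.
move: H1 H2; rewrite F' /F L0 /L tu nt /t => H1 H2; split.
  by move: H1; rewrite mulrA mulrAC.
by apply: le_trans H2 _; rewrite expr_div_n mulrA mulrAC.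
Qed.

(** A Cauchy estimate read off from the Taylor bounds: on |k| = rho / 2 these are M and 2 M, so the
    differential is at most 3 M there, and homogeneity does the rest. *)
Lemma diff_bound (h : V) : rnorm ('d f x h) <= 6 * M / rho * rnorm h.
Proof.
have M0 : 0 <= M by apply: le_trans (rnorm_ge0 _) (@fM x _); rewrite subrr rnorm0.
have small (k : V) : rnorm k = rho / 2 -> rnorm ('d f x k) <= 3 * M.
  move=> kr; have [|H1 H2] := @taylor_ball k.
    by rewrite kr ltr_pdivrMr // ltr_pMr // ltrDl.
  have := rnormD (f (x + k) - f x) (- (f (x + k) - f x - 'd f x k)).
  rewrite rnormN opprB addrC subrK; move: H1 H2; rewrite kr.
  have -> : 2 * M / rho * (rho / 2) = M by field; rewrite gt_eqF.
  have -> : 8 * M / rho ^+ 2 * (rho / 2) ^+ 2 = 2 * M by field; rewrite gt_eqF.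
  lra.
have [->|h0] := eqVneq h 0; first by rewrite linear0 !rnorm0 mulr0.
have nh : 0 < rnorm h.
  by rewrite lt_neqAle rnorm_ge0 andbT eq_sym; apply: contra_neq h0; exact: rnorm0_eq0.
pose s := rho / 2 / rnorm h.
have s0 : 0 < s by rewrite !divr_gt0.
have := small ((s%:C : R[i]) *: h).
rewrite linearZ !rnorm_realZ ger0_norm ?(ltW s0) // /s divfK ?gt_eqF // -/s.
move=> /(_ erefl); rewrite -ler_pdivlMl // => H; apply: le_trans H _.
rewrite le_eqVlt; apply/orP; left; apply/eqP; rewrite /s.
by field; rewrite !gt_eqF.
Qed.

End taylor_ball.

(** * Limits along an ultrafilter *)

Section ultralimit.
Variables (R : realType) (U : set_system nat).
Context {UU : UltraFilter U}.
Notation C := (R[i]^o).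
Notation Re := complex.Re.
Notation Im := complex.Im.

Definition ucvg (a : nat -> C) (l : C) : Prop :=
  forall e : R, 0 < e -> U [set n | rnorm (a n - l) <= e].

(** The default 0 does not interfere with bounded sequences, since these always converge along
    [U]. *)
Definition ulim (a : nat -> C) : C := xget 0 [set l | ucvg a l].

Lemma ucvg_unique a l m : ucvg a l -> ucvg a m -> l = m.
Proof.
move=> al am; apply/eqP; rewrite -subr_eq0; apply/eqP/rnorm0_eq0/eqP.
rewrite eq_le rnorm_ge0 andbT; apply/ler_addgt0Pr => e e0; rewrite add0r.
have e2 : 0 < e / 2 by rewrite divr_gt0.
have [n [/= n1 n2]] := filter_ex (filterI (al _ e2) (am _ e2)).
have -> : l - m = (a n - m) - (a n - l) by ring.
by apply: le_trans (rnormD _ _) _; rewrite rnormN; lra.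
Qed.

Lemma ulimE a l : ucvg a l -> ulim a = l.
Proof.
by move=> al; rewrite /ulim; case: xgetP => [m _ am|/(_ l)//]; exact: ucvg_unique am al.
Qed.

(** Compactness gives a cluster point. An ultrafilter contains each neighbourhood condition or its
    negation, and clustering excludes the negation. *)
Let ucvg_real (a : nat -> R) (M : R) : (forall n, `|a n| <= M) ->
  exists l : R, forall e : R, 0 < e -> U [set n | `|a n - l| <= e].
Proof.
move=> aM; have [|l [_ al]] := @segment_compact R (- M) M (a @ U).
  by apply: (@filterE _ U) => n /=; rewrite in_itv /= -ler_norml.
exists l => e e0.
have [//|nA] := in_ultra_setVsetC [set n | `|a n - l| <= e] UU.
have [||y [/= ey ly]] := al [set y | ~ `|y - l| <= e] (ball l e).
- exact: nA.
- exact: nbhsx_ballx.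
by exfalso; apply: ey; rewrite distrC; exact: ltW.
Qed.

Lemma ucvg_bounded a (M : R) : (forall n, rnorm (a n) <= M) -> ucvg a (ulim a).
Proof.
move=> aM.
have [|x ax] := @ucvg_real (fun n => Re (a n)) M.
  by move=> n; exact: le_trans (Re_le_rnorm _) (aM n).
have [|y ay] := @ucvg_real (fun n => Im (a n)) M.
  by move=> n; exact: le_trans (Im_le_rnorm _) (aM n).
have al : ucvg a (x +i* y).
  move=> e e0; have e2 : 0 < e / 2 by rewrite divr_gt0.
  apply: filterS2 (ax _ e2) (ay _ e2) => n /= h1 h2.
  by apply: le_trans (rnorm_le_ReIm _) _; rewrite !raddfB /=; lra.
by rewrite (ulimE al).
Qed.

Lemma ucvg_ext a b l : (forall n, a n = b n) -> ucvg a l -> ucvg b l.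
Proof. by move=> /funext ->. Qed.

Lemma ucvg_near a b l : U [set n | a n = b n] -> ucvg a l -> ucvg b l.
Proof.
by move=> ab al e /al; apply: filterS2 ab => n /= ->.
Qed.

Lemma ucvg_cst l : ucvg (fun=> l) l.
Proof.
by move=> e e0; apply: filterE => n /=; rewrite subrr rnorm0 ltW.
Qed.

Lemma ucvgD a b l m : ucvg a l -> ucvg b m -> ucvg (fun n => a n + b n) (l + m).
Proof.
move=> al bm e e0; have e2 : 0 < e / 2 by rewrite divr_gt0.
apply: filterS2 (al _ e2) (bm _ e2) => n /= h1 h2.
by rewrite opprD addrACA; apply: le_trans (rnormD _ _) _; lra.
Qed.

Lemma ucvgM a b l m (M : R) : (forall n, rnorm (a n) <= M) ->
  ucvg a l -> ucvg b m -> ucvg (fun n => a n * b n) (l * m).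
Proof.
move=> aM al bm e e0.
have M0 : 0 <= M by exact: le_trans (rnorm_ge0 _) (aM 0).
have m0 := rnorm_ge0 m.
have p : 0 < M + rnorm m + 1 by lra.
have e2 : 0 < e / (M + rnorm m + 1) by rewrite divr_gt0.
apply: filterS2 (al _ e2) (bm _ e2) => n /= h1 h2.
have -> : a n * b n - l * m = a n * (b n - m) + (a n - l) * m by ring.
apply: le_trans (rnormD _ _) _; rewrite !rnormM.
set k := e / _ in e2 h1 h2.
have -> : e = k * (M + rnorm m + 1) by rewrite divfK // gt_eqF.
have h3 : rnorm (a n) * rnorm (b n - m) <= M * k by rewrite ler_pM ?rnorm_ge0.
have h4 : rnorm (a n - l) * rnorm m <= k * rnorm m by rewrite ler_wpM2r.
by rewrite !mulrDr mulr1; lra.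
Qed.

Lemma ucvgZ (k : C) a l : ucvg a l -> ucvg (fun n => k * a n) (k * l).
Proof. by move=> al; apply: (@ucvgM (fun=> k) a k l (rnorm k)) => //; exact: ucvg_cst. Qed.

Lemma ucvg_le a l (M : R) : U [set n | rnorm (a n) <= M] -> ucvg a l -> rnorm l <= M.
Proof.
move=> aM al; apply/ler_addgt0Pr => e e0.
have [n [/= n1 n2]] := filter_ex (filterI aM (al e e0)).
rewrite -(subrK (a n) l); apply: le_trans (rnormD _ _) _.
by rewrite rnormC; lra.
Qed.

Lemma ulim_le a (M : R) : (forall n, rnorm (a n) <= M) -> rnorm (ulim a) <= M.
Proof.
by move=> aM; apply: (@ucvg_le a) (ucvg_bounded aM); exact: filterE.
Qed.

(* Montel's theorem in disguise: the quadratic Taylor remainder is uniform in n, so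
   it survives the limit. *)
Lemma ulim_differentiable (V : normedModType R[i]) (F : nat -> V -> C) (M : R)
    (x : V) (rho : R) : 0 < rho ->
  (forall n y, rnorm (y - x) < rho -> differentiable (F n) y) ->
  (forall n y, rnorm (y - x) < rho -> rnorm (F n y) <= M) ->
  differentiable (fun y => ulim (F ^~ y)) x.
Proof.
move=> rho0 dF FM.
have M0 : 0 <= M by apply: le_trans (rnorm_ge0 _) (FM 0%N x _); rewrite subrr rnorm0.
have DM n h : rnorm ('d (F n) x h) <= 6 * M / rho * rnorm h.
  by apply: diff_bound => // y; [exact: dF|exact: FM].
(* The candidate derivative is the limit of the derivatives, which exists because the Cauchy
   estimate is uniform in n. *)
pose D (h : V) : C := ulim (fun n => 'd (F n) x h).
have Dc h : ucvg (fun n => 'd (F n) x h) (D h) by exact: ucvg_bounded (DM ^~ h).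
have Dlin : linear D.
  move=> a u v; apply: ulimE.
  apply: ucvg_ext (ucvgD (ucvgZ a (Dc u)) (Dc v)) => n.
  by rewrite linearP.
pose HD := GRing.isLinear.Build R[i] V C *:%R D Dlin.
pose D' : {linear V -> C} := HB.pack D HD.
apply: (@eps_differentiable _ _ _ _ _ D' (6 * M / rho)).
  by move=> h; exact: ulim_le.
move=> e e0.
have p : 0 < 8 * M / rho ^+ 2 + 1.
  by rewrite ltr_wpDl // divr_ge0 ?sqr_ge0 // mulr_ge0.
exists (Num.min (rho / 2) (e / (8 * M / rho ^+ 2 + 1))).
  by rewrite lt_min !divr_gt0.
move=> h; rewrite le_min => /andP[h1 h2].
have hr : rnorm h < rho by lra.
have xh : rnorm (x + h - x) < rho by rewrite addrAC subrr add0r.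
have xx : rnorm (x - x) < rho by rewrite subrr rnorm0.
have Fc y : rnorm (y - x) < rho -> ucvg (F ^~ y) (ulim (F ^~ y)).
  by move=> yx; apply: ucvg_bounded => n; exact: FM.
have cc := ucvgD (ucvgD (Fc _ xh) (ucvgZ (-1) (Fc _ xx))) (ucvgZ (-1) (Dc h)).
move: cc; rewrite !mulN1r => cc.
apply: (ucvg_le _ cc); apply: filterE => n /=; rewrite !mulN1r.
have [||_ H] := @taylor_ball R V (F n) M x rho rho0 _ _ h hr.
- by move=> y; exact: dF.
- by move=> y; exact: FM.
apply: le_trans H _; rewrite expr2 mulrA ler_wpM2r ?rnorm_ge0 //.
move: h2; rewrite ler_pdivlMr // mulrDr mulr1 mulrC => h2.
by have := rnorm_ge0 h; lra.
Qed.

End ultralimit.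

(** * Operators on l2 *)

Section ell2_operators.
Variable R : realType.
Notation C := (R[i]^o).
Notation E := (ell2 R).

Lemma ell2_rnorm_sqr (u : E) :
  rnorm u ^+ 2 = limn (series (fun k => rnorm (u k) ^+ 2)).
Proof.
rewrite /rnorm /= sqr_sqrtr //; exact/sqsum_lim_ge0/ell2_cvg.
Qed.

Lemma ell2_psum_le (u : E) n : \sum_(k < n) rnorm (u k) ^+ 2 <= rnorm u ^+ 2.
Proof.
rewrite ell2_rnorm_sqr.
have := @sqsum_le_lim _ (fun k => rnorm (u k)) n (@ell2_cvg _ u).
by rewrite {1}seriesEnat /= big_mkord.
Qed.

Lemma ell2_rnorm_le (u : E) (c : R) : 0 <= c ->
  (forall n, \sum_(k < n) rnorm (u k) ^+ 2 <= c ^+ 2) -> rnorm u <= c.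
Proof.
move=> c0 uc; rewrite -ler_sqr ?nnegrE ?rnorm_ge0 // ell2_rnorm_sqr.
apply: limr_le; first exact: ell2_cvg.
by apply: nearW => n; rewrite seriesEnat /= big_mkord.
Qed.

Lemma ell2_psum_mem (u : nat -> C) (c : R) :
  (forall n, \sum_(k < n) rnorm (u k) ^+ 2 <= c) -> u \in @ell2_pred R.
Proof.
move=> uc; apply/ell2_predP.
apply: (@sqsum_bounded_cvg _ (fun k => rnorm (u k)) c) => n.
by rewrite seriesEnat /= big_mkord.
Qed.

Lemma ell2_ext (u v : E) : (forall k, u k = v k) -> u = v.
Proof. by move=> uv; apply/val_inj/funext. Qed.

(** [None] marks a coordinate to be filled with 0. Deleting a block, filling a block, extracting a
    column and shifting are all compositions with such maps, and injectivity makes them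
    contractions. *)
Definition partial_inj (s : nat -> option nat) : Prop :=
  forall i j k, s i = Some k -> s j = Some k -> i = j.

(** The indices hit by [s] are distinct and bounded by some m, so the left side is a subsum of the
    right side. *)
Lemma partial_inj_sum (s : nat -> option nat) (a : nat -> R) n :
  partial_inj s -> (forall k, 0 <= a k) ->
  exists m, \sum_(i < n) oapp a 0 (s i) <= \sum_(j < m) a j.
Proof.
move=> sI a0; pose l := pmap s (iota 0 n).
have lu : uniq l.
  rewrite /l; elim: n 0%N {l} => [|n IH] k //=.
  case e: (s k) => [j|] //=; rewrite IH andbT mem_pmap.
  apply/mapP => -[i0]; rewrite mem_iota => /andP[ki _] ei.
  by have := sI _ _ _ e (esym ei) => ik; move: ki; rewrite ik ltnn.
have [m lm] : exists m, forall j, j \in l -> (j < m)%N.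
  by exists (\max_(j <- l) j).+1 => j jl; rewrite ltnS; exact: leq_bigmax_seq.
exists m.
have -> : \sum_(i < n) oapp a 0 (s i) = \sum_(j <- l) a j.
  rewrite -(big_mkord xpredT (fun i => oapp a 0 (s i))) /index_iota subn0.
  rewrite /l; elim: (iota 0 n) => [|i r IH]; first by rewrite !big_nil.
  by rewrite big_cons IH /=; case: (s i) => [j|] /=; rewrite ?big_cons ?add0r.
have -> : \sum_(j < m) a j = \sum_(j <- iota 0 m) a j.
  by rewrite -(big_mkord xpredT a) /index_iota subn0.
rewrite [leRHS](bigID (mem l)) /=.
have -> : \sum_(i <- iota 0 m | i \in l) a i = \sum_(j <- l) a j.
  rewrite -big_filter; apply: perm_big; apply: uniq_perm => //.
    by rewrite filter_uniq ?iota_uniq.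
  by move=> j; rewrite mem_filter mem_iota /= add0n andb_idr //; exact: lm.
by rewrite lerDl sumr_ge0.
Qed.

Lemma pull_psum (s : nat -> option nat) (u : E) n : partial_inj s ->
  \sum_(k < n) rnorm (oapp u 0 (s k) : C) ^+ 2 <= rnorm u ^+ 2.
Proof.
move=> sI; have [|m] := @partial_inj_sum s (fun k => rnorm (u k) ^+ 2) n sI.
  by move=> k; exact: sqr_ge0.
move=> /le_trans/(_ (ell2_psum_le u m)); apply: le_trans.
rewrite le_eqVlt; apply/orP; left; apply/eqP; apply: eq_bigr => k _.
by case: (s k) => //=; rewrite rnorm0 expr0n.
Qed.

Definition pull (s : nat -> option nat) (sI : partial_inj s) (u : E) : E :=
  Ell2 (@ell2_psum_mem (fun k => oapp u 0 (s k)) _ (fun n => pull_psum u n sI)).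

Section pull.
Variables (s : nat -> option nat) (sI : partial_inj s).

Lemma pull_linear : linear (pull sI).
Proof.
move=> a u v; apply: ell2_ext => k.
rewrite -[LHS]/(oapp (a *: u + v) 0 (s k)).
rewrite -[RHS]/(a *: (oapp u 0 (s k) : C) + oapp v 0 (s k)).
by case: (s k) => //=; rewrite scaler0 addr0.
Qed.

Lemma pull_le u : rnorm (pull sI u) <= rnorm u.
Proof. by apply: ell2_rnorm_le => [|n]; [exact: rnorm_ge0|exact: pull_psum]. Qed.
End pull.

Lemma rnorm_add_disjoint (u v : E) (a b : R) :
  (forall k, u k = 0 \/ v k = 0) -> rnorm u <= a -> rnorm v <= b ->
  rnorm (u + v) ^+ 2 <= a ^+ 2 + b ^+ 2.
Proof.
move=> uv ua vb.
have a0 : 0 <= a by exact: le_trans (rnorm_ge0 _) ua.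
have b0 : 0 <= b by exact: le_trans (rnorm_ge0 _) vb.
have h0 : 0 <= a ^+ 2 + b ^+ 2 by rewrite addr_ge0 ?sqr_ge0.
rewrite -[leRHS]sqr_sqrtr // ler_sqr ?nnegrE ?rnorm_ge0 ?sqrtr_ge0 //.
apply: ell2_rnorm_le; first exact: sqrtr_ge0.
move=> n; rewrite sqr_sqrtr //.
have -> : \sum_(k < n) rnorm ((u + v) k) ^+ 2 =
   \sum_(k < n) rnorm (u k) ^+ 2 + \sum_(k < n) rnorm (v k) ^+ 2.
  rewrite -big_split; apply: eq_bigr => k _.
  rewrite -[LHS]/(rnorm (u k + v k) ^+ 2) /=.
  by case: (uv k) => ->; rewrite rnorm0 expr0n ?add0r ?addr0.
apply: lerD; apply: le_trans (ell2_psum_le _ _) _.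
  by rewrite lerXn2r ?nnegrE ?rnorm_ge0.
by rewrite lerXn2r ?nnegrE ?rnorm_ge0.
Qed.

Lemma ell2_conj_subproof (u : E) : (fun k => (u k)^*%C : C) \in @ell2_pred R.
Proof.
apply: (@ell2_psum_mem _ (rnorm u ^+ 2)) => n; apply: le_trans (ell2_psum_le u n).
rewrite le_eqVlt; apply/orP; left; apply/eqP; apply: eq_bigr => k _.
by congr (_ ^+ 2); apply: complexI; rewrite !rnormE normcJ.
Qed.

(** The pairing [ell2_dot] is bilinear, to be holomorphic in both arguments; the inner product of a
    and b is recovered as [ell2_dot a (ell2_conj b)]. *)
Definition ell2_conj (u : E) : E := Ell2 (ell2_conj_subproof u).

Lemma rnorm_ell2_conj u : rnorm (ell2_conj u) = rnorm u.
Proof.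
have le v : rnorm (ell2_conj v) <= rnorm v.
  apply: ell2_rnorm_le (rnorm_ge0 _) _ => n; apply: le_trans (ell2_psum_le v n).
  rewrite le_eqVlt; apply/orP; left; apply/eqP; apply: eq_bigr => k _.
  by congr (_ ^+ 2); apply: complexI; rewrite !rnormE normcJ.
apply/eqP; rewrite eq_le le /= -{1}[u](_ : ell2_conj (ell2_conj u) = u) ?le //.
by apply: ell2_ext => k /=; exact: conjcK.
Qed.

Lemma ell2_e0_subproof : (fun k => (k == 0%N)%:R : C) \in @ell2_pred R.
Proof.
apply: (@ell2_psum_mem _ 1) => -[|n]; first by rewrite big_ord0.
rewrite big_ord_recl big1 ?addr0; first by rewrite /rnorm normr1 expr1n.
by move=> k _; rewrite /= rnorm0 expr0n.
Qed.

Definition ell2_e0 : E := Ell2 ell2_e0_subproof.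

Lemma rnorm_ell2_e0 : rnorm ell2_e0 <= 1.
Proof.
apply: ell2_rnorm_le => // -[|n]; first by rewrite big_ord0 expr1n.
rewrite big_ord_recl big1 ?addr0; first by rewrite /rnorm normr1 expr1n.
by move=> k _; rewrite /= rnorm0 expr0n.
Qed.

Lemma cauchy_schwarz_psum (a b : E) n :
  rnorm (\sum_(k < n) a k * b k : C) <= rnorm a * rnorm b.
Proof.
have -> : rnorm a * rnorm b = rnorm b * rnorm a by rewrite mulrC.
have [a0|a0] := eqVneq (rnorm a) 0.
  rewrite big1 ?rnorm0 ?mulr_ge0 ?rnorm_ge0 // => k _.
  by rewrite (rnorm0_eq0 a0) mul0r.
have [b0|b0] := eqVneq (rnorm b) 0.
  rewrite big1 ?rnorm0 ?mulr_ge0 ?rnorm_ge0 // => k _.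
  by rewrite (rnorm0_eq0 b0) mulr0.
have pa : 0 < rnorm a by rewrite lt_neqAle eq_sym a0 rnorm_ge0.
have pb : 0 < rnorm b by rewrite lt_neqAle eq_sym b0 rnorm_ge0.
have h1 : rnorm (\sum_(k < n) a k * b k : C) <= \sum_(k < n) rnorm (a k) * rnorm (b k).
  elim/big_ind2: _ => [|x1 x2 y1 y2 hx hy|k _]; first by rewrite rnorm0.
    exact: le_trans (rnormD _ _) (lerD hx hy).
  by rewrite rnormM.
apply: le_trans h1 _.
(* The weight for which x y <= t / 2 x^2 + y^2 / (2 t) sums to exactly |a| |b|. *)
pose t := rnorm b / rnorm a; have t0 : 0 < t by rewrite divr_gt0.
have h2 : \sum_(k < n) rnorm (a k) * rnorm (b k) <=
   t / 2 * \sum_(k < n) rnorm (a k) ^+ 2 + t^-1 / 2 * \sum_(k < n) rnorm (b k) ^+ 2.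
  rewrite !mulr_sumr -big_split /=; apply: ler_sum => k _; rewrite -subr_ge0.
  move: (rnorm (a k)) (rnorm (b k)) => x y.
  have -> : t / 2 * x ^+ 2 + t^-1 / 2 * y ^+ 2 - x * y = t^-1 / 2 * (t * x - y) ^+ 2.
    by field; rewrite gt_eqF.
  by rewrite mulr_ge0 ?sqr_ge0 // divr_ge0 // invr_ge0 ltW.
apply: le_trans h2 _.
have -> : rnorm b * rnorm a = t / 2 * rnorm a ^+ 2 + t^-1 / 2 * rnorm b ^+ 2.
  by rewrite /t; field; rewrite !gt_eqF.
by apply: lerD; apply: ler_wpM2l (ell2_psum_le _ _);
  rewrite divr_ge0 // ?invr_ge0 ltW.
Qed.

Section bilinear.
Variable U : set_system nat.
Context {UU : UltraFilter U}.
Hypothesis oU : \oo `<=` U.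

(* The series converges absolutely, so the ultrafilter limit of its partial sums is
   its sum; the ultrafilter limit spares the convergence proof. *)
Definition ell2_dot (a b : E) : C := ulim U (fun n => \sum_(k < n) a k * b k).

Lemma ell2_dot_cvg (a b : E) : ucvg U (fun n => \sum_(k < n) a k * b k) (ell2_dot a b).
Proof. by apply: ucvg_bounded => n; exact: cauchy_schwarz_psum. Qed.

Lemma ell2_dot_le a b : rnorm (ell2_dot a b) <= rnorm a * rnorm b.
Proof. by apply: ulim_le => n; exact: cauchy_schwarz_psum. Qed.

Lemma ell2_dotC a b : ell2_dot a b = ell2_dot b a.
Proof.
congr ulim; apply/funext => n; apply: eq_bigr => k _; exact: mulrC.
Qed.

Lemma ell2_dot_linear (b : E) : linear (ell2_dot ^~ b).
Proof.
move=> c a a'; apply: ulimE.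
apply: ucvg_ext (ucvgD (ucvgZ c (ell2_dot_cvg a b)) (ell2_dot_cvg a' b)) => n.
rewrite mulr_sumr -big_split; apply: eq_bigr => k _.
rewrite -[RHS]/((c * a k + a' k : R[i]) * b k); rewrite /=; ring.
Qed.

Lemma ell2_dotDl a a' b : ell2_dot (a + a') b = ell2_dot a b + ell2_dot a' b.
Proof. by have := ell2_dot_linear b 1 a a'; rewrite !scale1r. Qed.

Lemma ell2_dotDr a b b' : ell2_dot a (b + b') = ell2_dot a b + ell2_dot a b'.
Proof. by rewrite ell2_dotC ell2_dotDl; congr (_ + _); exact: ell2_dotC. Qed.

Lemma ell2_dotZl c a b : ell2_dot (c *: a) b = c * ell2_dot a b.
Proof.
have d0 : ell2_dot 0 b = 0.
  by have := ell2_dotDl 0 0 b; rewrite addr0 -{1}[ell2_dot 0 b]addr0 => /addrI <-.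
by have := ell2_dot_linear b c a 0; rewrite !addr0 d0 => ->; rewrite addr0.
Qed.

Lemma ell2_dotZr c a b : ell2_dot a (c *: b) = c * ell2_dot a b.
Proof. by rewrite ell2_dotC ell2_dotZl ell2_dotC. Qed.

Lemma ell2_dot_single (a b : E) n : (forall k, k != n -> b k = 0) ->
  ell2_dot a b = a n * b n.
Proof.
move=> bn; apply: ulimE; apply: ucvg_near (ucvg_cst _); apply: oU.
exists n.+1 => // m /= nm.
rewrite (bigD1 (Ordinal nm)) //= big1 ?addr0 // => k kn.
by rewrite bn ?mulr0 //; apply: contra_neq kn => e; exact/val_inj.
Qed.

Lemma ell2_dot_conj a : ell2_dot a (ell2_conj a) = (rnorm a ^+ 2)%:C.
Proof.
apply: ulimE => e e0; apply: oU.
have /cvgrPdist_le/(_ e e0) := @ell2_cvg _ a.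
apply: filterS => n /=; rewrite -ell2_rnorm_sqr distrC seriesEnat /= big_mkord => ne.
have -> : \sum_(k < n) (a k * (a k)^*%C : C) = (\sum_(k < n) rnorm (a k) ^+ 2)%:C.
  rewrite rmorph_sum /=; apply: eq_bigr => k _.
  by rewrite rmorphXn /= rnormE -sqr_normc.
by rewrite -rmorphB /= rnorm_real.
Qed.

End bilinear.
End ell2_operators.

(** * Bounded linear maps and the product rule *)

Section differentiable_lemmas.
Variables (R : realType) (V W : normedModType R[i]).
Notation C := (R[i]^o).

Lemma linear_bounded_differentiable (D : V -> W) (K : R) (x : V) : linear D ->
  (forall h, rnorm (D h) <= K * rnorm h) -> differentiable D x.
Proof.
move=> Dlin DK; pose HD := GRing.isLinear.Build R[i] V W *:%R D Dlin.
pose D' : {linear V -> W} := HB.pack D HD.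
apply: (@eps_differentiable _ _ _ _ _ D' K) => // e e0; exists 1 => // h _.
rewrite -[D (x + h)]/(D' (x + h)) -[D x]/(D' x) linearD [D' x + _]addrC addrK subrr.
by rewrite rnorm0 mulr_ge0 ?rnorm_ge0 // ltW.
Qed.

Lemma scale_differentiable (k : V -> C) (f : V -> W) (x : V) :
  differentiable k x -> differentiable f x ->
  differentiable (fun y => k y *: f y) x.
Proof.
move=> dk df.
have [[Kk Kk0 DKk] ek] := differentiable_eps dk.
have [[Kf Kf0 DKf] ef] := differentiable_eps df.
have [Lk Lk0 [dk0 dk00 lk]] := differentiable_lipschitz dk.
have [Lf Lf0 [df0 df00 lf]] := differentiable_lipschitz df.
pose D (h : V) : W := k x *: 'd f x h + 'd k x h *: f x.
have Dlin : linear D.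
  move=> a u v; rewrite /D !linearP /= -[(_ + _ : R[i]^o) *: f x]/((_ + _) *: f x).
  by rewrite scalerDl !scalerA [k x * a]mulrC addrACA.
pose HD := GRing.isLinear.Build R[i] V W *:%R D Dlin.
pose D' : {linear V -> W} := HB.pack D HD.
apply: (@eps_differentiable _ _ _ _ _ D' (rnorm (k x) * Kf + Kk * rnorm (f x))).
  move=> h; apply: le_trans (rnormD _ _) _; rewrite !rnormZ mulrDl.
  apply: lerD; first by rewrite -mulrA ler_wpM2l ?rnorm_ge0.
  by rewrite mulrAC ler_wpM2r ?rnorm_ge0.
move=> e e0.
(* The error consists of two first-order remainders, weighted by |k x| and |f x|, and the product of
   the increments with weight 1; [q] is the sum of the weights. *)
pose q := rnorm (k x) + rnorm (f x) + 1.
have q0 : 0 < q by have := rnorm_ge0 (k x); have := rnorm_ge0 (f x); rewrite /q; lra.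
pose e1 := e / q; have e10 : 0 < e1 by rewrite divr_gt0.
have [d1 d10 h1] := ek _ e10; have [d2 d20 h2] := ef _ e10.
have L0 : 0 < Lk * Lf by rewrite mulr_gt0.
exists (Num.min (Num.min d1 d2) (Num.min (Num.min dk0 df0) (e1 / (Lk * Lf)))).
  by rewrite !lt_min d10 d20 dk00 df00 divr_gt0.
move=> h; rewrite !le_min => /andP[/andP[hd1 hd2] /andP[/andP[hdk hdf] hL]].
have -> : k (x + h) *: f (x + h) - k x *: f x - D' h =
  k x *: (f (x + h) - f x - 'd f x h) + (k (x + h) - k x - 'd k x h) *: f x
  + (k (x + h) - k x) *: (f (x + h) - f x).
  rewrite -[D' h]/(D h) /D; set a := 'd f x h; set b := 'd k x h.
  set K := k (x + h); set F := f (x + h).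
  rewrite [in RHS]scalerBr [(K - k x - b) *: f x]scalerBl.
  rewrite [(K - k x) *: f x]scalerBl [(K - k x) *: (F - f x)]scalerBl.
  rewrite [K *: (F - f x)]scalerBr.
  move: (k x *: (F - f x)) (K *: F) (K *: f x) => p m m'.
  apply/esym; rewrite addrAC [p - _]addrC -[_ + p + _]addrA [p + _]addrC subrK.
  by rewrite [- _ + _]addrC addrACA [_ - _ + (_ - _)]addrA subrK -opprD.
have n1 := rnormD (k x *: (f (x + h) - f x - 'd f x h) +
  (k (x + h) - k x - 'd k x h) *: f x) ((k (x + h) - k x) *: (f (x + h) - f x)).
have n2 := rnormD (k x *: (f (x + h) - f x - 'd f x h))
  ((k (x + h) - k x - 'd k x h) *: f x).
have m1 : rnorm (k x *: (f (x + h) - f x - 'd f x h)) <= rnorm (k x) * (e1 * rnorm h).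
  by rewrite rnormZ ler_wpM2l ?rnorm_ge0 // h2.
have m2 : rnorm ((k (x + h) - k x - 'd k x h) *: f x) <= e1 * rnorm h * rnorm (f x).
  by rewrite rnormZ ler_wpM2r ?rnorm_ge0 // h1.
have m3 : rnorm ((k (x + h) - k x) *: (f (x + h) - f x)) <= e1 * rnorm h.
  rewrite rnormZ; apply: le_trans (ler_pM _ _ (lk _ hdk) (lf _ hdf)) _;
    rewrite ?rnorm_ge0 //.
  rewrite ler_pdivlMr // in hL.
  have -> : Lk * rnorm h * (Lf * rnorm h) = rnorm h * (Lk * Lf) * rnorm h by ring.
  by rewrite ler_wpM2r ?rnorm_ge0.
have -> : e * rnorm h = rnorm (k x) * (e1 * rnorm h) + e1 * rnorm h * rnorm (f x)
  + e1 * rnorm h by rewrite /e1 /q; field; rewrite gt_eqF.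
by clear -n1 n2 m1 m2 m3; lra.
Qed.

End differentiable_lemmas.

(** * Schwarz lemma on the Hilbert ball and the gap along the kernel *)

Section gap.
Variables (R : realType) (U : set_system nat).
Context {UU : UltraFilter U}.
Hypothesis oU : \oo `<=` U.
Notation C := (R[i]^o).
Notation E := (ell2 R).
Notation dot := (@ell2_dot R U).

Lemma rnorm_conj (z : C) : rnorm (z^*%C : C) = rnorm z.
Proof. by apply: complexI; rewrite !rnormE normcJ. Qed.

Lemma ell2_dot_conj2 (a b : E) : dot (ell2_conj a) (ell2_conj b) = (dot a b)^*%C.
Proof.
apply: ulimE => e /(@ell2_dot_cvg R U UU a b); apply: filterS => n /=.
rewrite -rnorm_conj rmorphB /= rmorph_sum /=.
rewrite (eq_bigr (fun k : 'I_n => (a k)^*%C * (b k)^*%C)) //.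
by move=> k _; rewrite rmorphM.
Qed.

Lemma pythagoras (y v : E) (t : R[i]) : dot y (ell2_conj v) = 0 ->
  rnorm (y + t *: v) ^+ 2 = rnorm y ^+ 2 + rnorm (t *: v) ^+ 2.
Proof.
move=> yv.
have vy : dot (t *: v) (ell2_conj y) = 0.
  rewrite ell2_dotZl // ell2_dotC.
  have -> : dot (ell2_conj y) v = (dot y (ell2_conj v))^*%C.
    rewrite -ell2_dot_conj2; congr ell2_dot.
    by apply: ell2_ext => k /=; rewrite conjcK.
  by rewrite yv conjc0 mulr0.
have conjD a b : ell2_conj (a + b) = ell2_conj a + ell2_conj b :> E.
  apply: ell2_ext => k; rewrite -[RHS]/((a k)^*%C + (b k)^*%C) -[LHS]/((a k + b k)^*%C).
  exact: rmorphD.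
have conjZ c a : ell2_conj (c *: a) = c^*%C *: ell2_conj a :> E.
  apply: ell2_ext => k; rewrite -[RHS]/(c^*%C * (a k)^*%C) -[LHS]/((c * a k)^*%C).
  exact: rmorphM.
apply: complexI; rewrite rmorphD /= -!(ell2_dot_conj oU) conjD.
rewrite ell2_dotDl // !ell2_dotDr // vy add0r.
by rewrite conjZ ell2_dotZr // yv mulr0 addr0.
Qed.

(** The scalar Schwarz lemma for z |-> <f (z u), f x> with u = x / |x|. This function is bounded by
    M |f x|, and its value at z = |x| is |f x|^2. *)
Lemma schwarz_ell2 (f : E -> E) (M : R) : holomorphic f -> f 0 = 0 ->
  (forall x, uball x -> rnorm (f x) <= M) ->
  forall x, uball x -> rnorm (f x) <= M * rnorm x.
Proof.
move=> df f0 fM x x1.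
have M0 : 0 <= M by exact: le_trans (rnorm_ge0 _) (fM x x1).
have [w0|w0] := eqVneq (f x) 0; first by rewrite w0 rnorm0 mulr_ge0 ?rnorm_ge0.
have x0 : x != 0 by apply: contra_neq w0 => ->.
have nx : 0 < rnorm x.
  by rewrite lt_neqAle rnorm_ge0 andbT eq_sym; apply: contra_neq x0; exact: rnorm0_eq0.
have nw : 0 < rnorm (f x).
  by rewrite lt_neqAle rnorm_ge0 andbT eq_sym; apply: contra_neq w0; exact: rnorm0_eq0.
pose w := ell2_conj (f x).
have nwE : rnorm w = rnorm (f x) by exact: rnorm_ell2_conj.
pose u : E := ((rnorm x)^-1)%:C *: x.
have nu : rnorm u = 1 by rewrite rnorm_realZ ger0_norm ?invr_ge0 ?rnorm_ge0 // mulVf ?gt_eqF.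
pose phi (z : C) : C := dot (f (z *: u)) w.
have zu (z : C) : rnorm z < 1 -> uball (z *: u).
  by move=> z1; apply/uball_rnorm; rewrite rnormZ nu mulr1.
have := @schwarz R phi (M * rnorm (f x)) _ _ _ (rnorm x)%:C.
rewrite rnorm_real ger0_norm ?rnorm_ge0 // {4}/phi.
have -> : (rnorm x)%:C *: u = x.
  by rewrite scalerA -rmorphM divff ?gt_eqF // scale1r.
rewrite (ell2_dot_conj oU) rnorm_real ger0_norm ?sqr_ge0 // => H.
suff : rnorm (f x) ^+ 2 <= M * rnorm (f x) * rnorm x.
  by rewrite expr2 mulrAC ler_pM2r.
apply: H.
- move=> z z1.
  apply: (@differentiable_comp _ _ _ _ (fun z : C => f (z *: u)) (dot ^~ w)).
    apply: (@differentiable_comp _ _ _ _ (fun z : C => z *: u) f).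
      exact: (@differentiableZl _ _ _ id).
    exact/df/zu.
  apply: (@linear_bounded_differentiable _ _ _ _ (rnorm w)).
    exact: ell2_dot_linear.
  by move=> h; rewrite mulrC; exact: ell2_dot_le.
- move=> z z1; apply: le_trans (ell2_dot_le _ _) _; rewrite nwE.
  by rewrite ler_wpM2r ?rnorm_ge0 // fM //; exact: zu.
- by rewrite /phi scale0r f0 -(scale0r 0) ell2_dotZl // mul0r.
- exact/uball_rnorm.
Qed.

(* Since [g] factors through [P], the value [g x] depends on [x] only through
   [P x], and |P x|^2 <= |x|^2 - |<x, v>|^2 / |v|^2 for [v] in the kernel of [P]. *)
Lemma kernel_gap (g : hinf E E)
    (g_ball : forall x, uball x -> uball (g x))
    (g_osc : `|g 0| + `|g - hcst E (g 0)| <= 1)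
    (P : {linear E -> E}) (v : E) (P1 : (opnorm P <= 1)%E)
    (v0 : v != 0) (Pv : P v = 0) (gP : forall x, uball x -> g x = g (P x)) :
  exists l : E -> C, [/\ linear l, exists K, forall x, rnorm (l x) <= K * rnorm x,
    exists w, l w != 0 &
    forall x w, uball x -> rnorm w <= 2 ->
      rnorm (g x) ^+ 2 + rnorm (l x *: w : E) ^+ 2 < 1].
Proof.
have nv : 0 < rnorm v.
  by rewrite lt_neqAle rnorm_ge0 andbT eq_sym; apply: contra_neq v0; exact: rnorm0_eq0.
pose G := rnorm (g 0).
have G1 : G < 1 by apply/uball_rnorm/g_ball; exact: uball0.
have G0 : 0 <= G by exact: rnorm_ge0.
have Ple x : rnorm (P x) <= rnorm x.
  have [->|x0] := eqVneq x 0; first by rewrite linear0.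
  have nx : 0 < rnorm x.
    by rewrite lt_neqAle rnorm_ge0 andbT eq_sym; apply: contra_neq x0; exact: rnorm0_eq0.
  have : ((rnorm (P (((rnorm x)^-1)%:C *: x)))%:E <= 1)%E.
    apply: le_trans P1; apply: ereal_sup_ubound.
    exists (((rnorm x)^-1)%:C *: x) => //=.
    rewrite -rnormE rnorm_realZ ger0_norm ?invr_ge0 ?rnorm_ge0 //.
    by rewrite mulVf ?gt_eqF.
  rewrite lee_fin linearZ rnorm_realZ ger0_norm ?invr_ge0 ?rnorm_ge0 //.
  by rewrite ler_pdivrMl // mulr1.
have gle y : uball y -> rnorm (g y) <= G + (1 - G) * rnorm y.
  move=> y1; pose f := g - hcst E (g 0).
  have fE x : uball x -> f x = g x - g 0.
    move=> x1; rewrite -[f x]/(g x - hcst E (g 0) x); congr (_ - _).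
    exact: (on_ball_in _ x1).
  have fN : rnorm f <= 1 - G.
    rewrite lerBrDl -lecR rmorphD /= !rnormE; exact: g_osc.
  have f0 : f 0 = 0 by rewrite fE ?subrr //; exact: uball0.
  have fb x : uball x -> rnorm (f x) <= rnorm f.
    by move=> x1; rewrite -lecR !rnormE; exact: hinf_norm_ge.
  have H := @schwarz_ell2 f (rnorm f) (@hinf_holomorphic _ _ _ f) f0 fb y y1.
  rewrite (fE y y1) in H.
  have := rnormD (g y - g 0) (g 0); rewrite subrK => /le_trans; apply.
  rewrite addrC lerD2l; apply: le_trans H _.
  by rewrite ler_wpM2r ?rnorm_ge0.
(* Chosen so that |l x| |w| <= (1 - G) tau / 2 for |w| <= 2, with [tau] the length of the component
   of x along v. It is positive because [g 0] lies in the open ball. *)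
pose c := (1 - G) / (4 * rnorm v).
have c0 : 0 < c by rewrite divr_gt0 ?mulr_gt0 // subr_gt0.
exists (fun x => c%:C * dot x (ell2_conj v)); split.
- move=> a x y; rewrite (ell2_dot_linear _ a x y) mulrDr; congr (_ + _).
  by rewrite -[RHS]/(a * _) -[a *: _]/(a * _) mulrCA.
- exists (c * rnorm v) => x; rewrite rnormM rnorm_real ger0_norm ?(ltW c0) //.
  have := ler_wpM2l (ltW c0) (@ell2_dot_le R U UU x (ell2_conj v)).
  by rewrite rnorm_ell2_conj [rnorm x * _]mulrC mulrA.
- exists v; rewrite (ell2_dot_conj oU) -rmorphM /=; apply/eqP => /complexI/eqP.
  by rewrite gt_eqF // mulr_gt0 // exprn_gt0.
move=> x w x1 w2.
have nx1 : rnorm x < 1 by exact/uball_rnorm.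
pose t : R[i] := dot x (ell2_conj v) / (rnorm v ^+ 2)%:C.
pose y := x - t *: v.
have yv : dot y (ell2_conj v) = 0.
  rewrite /y -scaleNr ell2_dotDl // ell2_dotZl // (ell2_dot_conj oU) /t mulNr.
  rewrite divfK ?subrr // -[0]/(0%:C); apply/eqP => /complexI/eqP.
  by rewrite gt_eqF // exprn_gt0.
have xE : x = y + t *: v by rewrite subrK.
have Py : rnorm (P x) <= rnorm y.
  by have := Ple y; rewrite /y linearB linearZ /= Pv scaler0 subr0.
pose tau := rnorm (t *: v).
have tau0 : 0 <= tau by exact: rnorm_ge0.
have xy : rnorm x ^+ 2 = rnorm y ^+ 2 + tau ^+ 2 by rewrite {1}xE pythagoras.
have Px1 : uball (P x) by apply/uball_rnorm; exact: le_lt_trans (Ple x) nx1.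
(* By Pythagoras |y|^2 < 1 - tau^2, and 2 |y| <= 1 + |y|^2 turns this into |y| < 1 - tau^2 / 2. *)
have gx : rnorm (g x) < 1 - (1 - G) * (tau ^+ 2 / 2).
  rewrite gP //; apply: le_lt_trans (gle _ Px1) _.
  have -> : 1 - (1 - G) * (tau ^+ 2 / 2) = G + (1 - G) * (1 - tau ^+ 2 / 2) by ring.
  rewrite ltrD2l ltr_pM2l ?subr_gt0 //; apply: le_lt_trans Py _.
  have x2 : rnorm x ^+ 2 < 1 by rewrite expr_lt1 ?rnorm_ge0.
  have := sqr_ge0 (rnorm y - 1); rewrite sqrrB expr1n mulr1.
  by clear -x2 xy; lra.
have lw : rnorm ((c%:C * dot x (ell2_conj v)) *: w) <= (1 - G) * tau / 2.
  rewrite rnormZ rnormM rnorm_real ger0_norm ?(ltW c0) //.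
  have -> : rnorm (dot x (ell2_conj v)) = tau * rnorm v.
    rewrite /tau rnormZ /t rnormM rnormV rnorm_real ger0_norm ?sqr_ge0 //.
    by field; rewrite gt_eqF.
  have -> : (1 - G) * tau / 2 = c * (tau * rnorm v) * 2.
    by rewrite /c; field; rewrite gt_eqF.
  apply: ler_wpM2l w2.
  by rewrite mulr_ge0 ?(ltW c0) // mulr_ge0 // ltW.
have g1 : rnorm (g x) ^+ 2 <= rnorm (g x).
  rewrite expr2 ler_piMl ?rnorm_ge0 // ltW //.
  by apply/uball_rnorm; exact: g_ball.
have lw2 : rnorm ((c%:C * dot x (ell2_conj v)) *: w) ^+ 2 <= ((1 - G) * tau / 2) ^+ 2.
  rewrite lerXn2r ?nnegrE ?rnorm_ge0 //.
  by rewrite !mulr_ge0 ?invr_ge0 // subr_ge0 ltW.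
(* The loss of |g x| is linear in 1 - G and the inserted square is quadratic in it, while 1 - G <=
   1. *)
have tl : ((1 - G) * tau / 2) ^+ 2 <= (1 - G) * (tau ^+ 2 / 2).
  rewrite -subr_ge0.
  have -> : (1 - G) * (tau ^+ 2 / 2) - ((1 - G) * tau / 2) ^+ 2 =
    (1 - G) * (1 + G) * (tau ^+ 2 / 4) by field.
  rewrite !mulr_ge0 ?sqr_ge0 ?subr_ge0 ?invr_ge0 //; first exact: ltW.
  by rewrite addr_ge0.
by clear -gx g1 lw2 tl; lra.
Qed.

End gap.

(** * Coordinate blocks and the detecting quadratic forms *)

Section blocks.
Variable R : realType.
Notation C := (R[i]^o).
Notation E := (ell2 R).

(* The n-th block of coordinates is { pickle (n, j) : j in nat }. *)
Definition block_index (n i : nat) : option nat :=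
  if (pickle_inv i : option (nat * nat)) is Some (m, j) then
    if m == n then Some j else None
  else None.

Lemma block_index_pickle n m j :
  block_index n (pickle (m, j)) = if m == n then Some j else None.
Proof. by rewrite /block_index pickleK_inv. Qed.

Lemma block_index_inj n : partial_inj (block_index n).
Proof.
have inv i k : block_index n i = Some k -> i = pickle (n, k).
  rewrite /block_index; have := @pickle_invK (nat * nat)%type i.
  case: (pickle_inv i) => [[m j]|] //= <-.
  by case: eqP => // -> [->].
by move=> i j k /inv -> /inv ->.
Qed.

Definition off_block (n i : nat) : option nat :=
  if block_index n i is Some _ then None else Some i.

Lemma off_block_inj n : partial_inj (off_block n).
Proof.
by move=> i j k; rewrite /off_block; do 2!case: (block_index n _) => //; move=> [->] [->].
Qed.

(** Pulling back along [column j] collects the j-th entries of all blocks in one sequence, indexed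
    by the block number. *)
Definition column (j m : nat) : option nat := Some (pickle (m, j)).

Lemma column_inj j : partial_inj (column j).
Proof.
move=> m m' k [<-] [] /(congr1 (pickle_inv (T := (nat * nat)%type))).
by rewrite !pickleK_inv => -[].
Qed.

Definition predn_opt (i : nat) : option nat := if i is j.+1 then Some j else None.

Lemma predn_opt_inj : partial_inj predn_opt.
Proof. by case=> [|i] [|j] k //= [->] [->]. Qed.

Definition splice (n : nat) (u w : E) : E :=
  pull (@off_block_inj n) u + pull (@block_index_inj n) w.

Lemma spliceE n u w i :
  splice n u w i = if block_index n i is Some j then w j else u i.
Proof.
rewrite -[LHS]/((oapp u 0 (off_block n i) : C) + oapp w 0 (block_index n i)).
by rewrite /off_block; case: (block_index n i) => [j|] /=; rewrite ?add0r ?addr0.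
Qed.

Lemma rnorm_splice n u w :
  rnorm (splice n u w) ^+ 2 <= rnorm u ^+ 2 + rnorm w ^+ 2.
Proof.
apply: rnorm_add_disjoint (pull_le _ _) (pull_le _ _) => k /=.
rewrite /off_block; case: (block_index n k) => [j|] /=; by [left|right].
Qed.

Lemma splice_differentiable (X : normedModType R[i]) n (a b : X -> E) x :
  differentiable a x -> differentiable b x ->
  differentiable (fun y => splice n (a y) (b y)) x.
Proof.
have pd s (sI : partial_inj s) (c : X -> E) :
    differentiable c x -> differentiable (fun y => pull sI (c y)) x.
  move=> dc; apply: (@differentiable_comp _ _ _ _ c (pull sI)) => //.
  apply: (@linear_bounded_differentiable _ _ _ _ 1); first exact: pull_linear.
  by move=> h; rewrite mul1r; exact: pull_le.
move=> da db; apply: differentiableD; exact: pd.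
Qed.

Definition cons1 (h : E) : E := ell2_e0 R + pull predn_opt_inj h.

Lemma cons10 h : cons1 h 0%N = 1.
Proof. by rewrite -[LHS]/((1 : C) + 0) addr0. Qed.

Lemma cons1S h j : cons1 h j.+1 = h j.
Proof. by rewrite -[LHS]/((0 : C) + h j) add0r. Qed.

Lemma rnorm_cons1 h : rnorm h <= 1 -> rnorm (cons1 h) <= 2.
Proof.
move=> h1; apply: le_trans (rnormD _ _) _; rewrite [leRHS](_ : 2 = 1 + 1) //.
by apply: lerD; [exact: rnorm_ell2_e0|exact: le_trans (pull_le _ _) h1].
Qed.

Lemma cons1_differentiable (X : normedModType R[i]) (a : X -> E) x :
  differentiable a x -> differentiable (fun y => cons1 (a y)) x.
Proof.
move=> da; apply: differentiableD; first exact: differentiable_cst.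
apply: (@differentiable_comp _ _ _ _ a (pull predn_opt_inj)) => //.
apply: (@linear_bounded_differentiable _ _ _ _ 1); first exact: pull_linear.
by move=> h; rewrite mul1r; exact: pull_le.
Qed.

Section quadratic.
Variable U : set_system nat.
Context {UU : UltraFilter U}.
Hypothesis oU : \oo `<=` U.
Notation dot := (@ell2_dot R U).

(** A bounded bilinear form on the diagonal: uniformly continuous on the ball, yet sensitive to
    perturbations that vanish coordinatewise in the limit. *)
Definition column_form (j : nat) (z : E) : C :=
  dot (pull (@column_inj 0) z) (pull (@column_inj j.+1) z).

Let col j := pull (@column_inj j) : E -> E.

Lemma colD j u w : col j (u + w) = col j u + col j w.
Proof. by have := pull_linear (@column_inj j) 1 u w; rewrite !scale1r. Qed.

Lemma column_formD j z h : column_form j (z + h) =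
  column_form j z + (dot (col 0 z) (col j.+1 h) + dot (col 0 h) (col j.+1 z))
  + column_form j h.
Proof.
rewrite /column_form -!/(col _ _) !colD ell2_dotDl // !ell2_dotDr //.
rewrite -!addrA; congr (_ + _); congr (_ + _); exact: addrA.
Qed.

Lemma dot_col_le i j z w : rnorm (dot (col i z) (col j w)) <= rnorm z * rnorm w.
Proof.
by apply: le_trans (ell2_dot_le _ _) _; rewrite ler_pM ?rnorm_ge0 ?pull_le.
Qed.

Lemma column_form_differentiable j z : differentiable (column_form j) z.
Proof.
pose D h := dot (col 0 z) (col j.+1 h) + dot (col 0 h) (col j.+1 z).
have Dlin : linear D.
  move=> a u v; rewrite /D /col !pull_linear !ell2_dotDl // !ell2_dotDr //.
  rewrite !ell2_dotZl // !ell2_dotZr // addrACA; congr (_ + _).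
  by rewrite -mulrDr.
pose HD := GRing.isLinear.Build R[i] E C *:%R D Dlin.
pose D' : {linear E -> C} := HB.pack D HD.
apply: (@eps_differentiable _ _ _ _ _ D' (2 * rnorm z)).
  move=> h; apply: le_trans (rnormD _ _) _.
  have := dot_col_le 0 j.+1 z h; have := dot_col_le 0 j.+1 h z.
  by rewrite [rnorm h * _]mulrC -mulrA; lra.
move=> e e0; exists e => // h he.
have -> : column_form j (z + h) - column_form j z - D' h = column_form j h.
  by rewrite column_formD -[D' h]/(D h) /D; ring.
apply: le_trans (dot_col_le _ _ _ _) _; rewrite ler_wpM2r ?rnorm_ge0 //.
Qed.

Lemma column_form_unif j : unif_continuous
  (column_form j : subspace (@uball R E) -> C).
Proof.
apply/unif_contP => e e0; exists (e / 3); first by rewrite divr_gt0.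
move=> x y /uball_rnorm x1 /uball_rnorm y1 xy.
have -> : column_form j x - column_form j y =
  dot (col 0 y) (col j.+1 (x - y)) + dot (col 0 (x - y)) (col j.+1 x).
  have {1}-> : x = y + (x - y) by rewrite addrC subrK.
  rewrite column_formD.
  have -> : dot (col 0 (x - y)) (col j.+1 x) =
     dot (col 0 (x - y)) (col j.+1 y) + column_form j (x - y).
    rewrite /column_form -!/(col _ _) -ell2_dotDr // -colD.
    by congr (dot _ (col _ _)); rewrite addrC subrK.
  by ring.
apply: le_lt_trans (rnormD _ _) _.
have h1 := dot_col_le 0 j.+1 y (x - y); have h2 := dot_col_le 0 j.+1 (x - y) x.
have h3 : rnorm y * rnorm (x - y) <= rnorm (x - y).
  by rewrite ler_piMl ?rnorm_ge0 // ltW.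
have h4 : rnorm (x - y) * rnorm x <= rnorm (x - y).
  by rewrite ler_piMr ?rnorm_ge0 // ltW.
by clear -h1 h2 h3 h4 xy e0; lra.
Qed.

(** Equal leading entries make the columns 0 agree, and the columns j + 1 differ only at position n,
    so the bilinear form collapses to one term. *)
Lemma column_form_splice j n (u w w' : E) : w 0%N = w' 0%N ->
  column_form j (splice n u w) - column_form j (splice n u w') =
  w 0%N * (w j.+1 - w' j.+1).
Proof.
move=> w0; rewrite /column_form -!/(col _ _).
have colE i v k : col i (splice n u v) k = if k == n then v i else u (pickle (k, i)).
  rewrite -[LHS]/(splice n u v (pickle (k, i))) spliceE block_index_pickle.
  by case: (k == n).
have -> : col 0 (splice n u w') = col 0 (splice n u w).
  by apply: ell2_ext => k; rewrite !colE w0.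
have {1}-> : col j.+1 (splice n u w) =
  col j.+1 (splice n u w') + (col j.+1 (splice n u w) - col j.+1 (splice n u w')).
  by rewrite addrC subrK.
rewrite ell2_dotDr // addrAC subrr add0r.
set d := _ - _.
have dE k : d k = col j.+1 (splice n u w) k - col j.+1 (splice n u w') k by [].
rewrite (ell2_dot_single oU _ (n := n)); last first.
  by move=> k /negbTE kn; rewrite dE !colE kn subrr.
by rewrite dE !colE eqxx.
Qed.

End quadratic.
End blocks.

(** * The embedding into the fiber *)

Section fiber_embedding.
Variables (R : realType) (U : set_system nat).
Context {UU : UltraFilter U}.
Hypothesis oU : \oo `<=` U.
Notation C := (R[i]^o).
Notation E := (ell2 R).
Notation HEE := (hinf E E).
Notation HE := (hinf E C).

Variables (g : HEE) (l : E -> C) (K : R).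
Hypothesis l_lin : linear l.
Hypothesis l_le : forall x, rnorm (l x) <= K * rnorm x.
Hypothesis gap : forall x w, uball x -> rnorm w <= 2 ->
  rnorm (g x) ^+ 2 + rnorm (l x *: w : E) ^+ 2 < 1.

Lemma hinf_linE (a : R[i]) (F F' : HE) x : (a *: F + F') x = a * F x + F' x.
Proof. by []. Qed.

Lemma hinf_mulE (F F' : HE) x : (F * F') x = F x * F' x.
Proof. by []. Qed.

Definition spliced (h : HEE) (n : nat) (x : E) : E :=
  splice n (g x) (l x *: cons1 (h x)).

Lemma hinf_le1 (h : HEE) x : uball h -> uball x -> rnorm (h x) <= 1.
Proof.
move=> /uball_rnorm h1 x1; apply: le_trans (ltW h1).
by rewrite -lecR !rnormE; exact: hinf_norm_ge.
Qed.

(** The purpose of [gap]: its bound 2 on |w| is the 1 + 1 from the leading entry and from [h x]. *)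
Lemma spliced_ball h n x : uball h -> uball x -> uball (spliced h n x).
Proof.
move=> h1 x1; apply/uball_rnorm; rewrite -(@expr_lt1 _ 2) ?rnorm_ge0 //.
apply: le_lt_trans (rnorm_splice _ _ _) (gap x1 _).
exact/rnorm_cons1/hinf_le1.
Qed.

Definition ulim_comp (f : au E) (h : HEE) (x : E) : C :=
  ulim U (fun n => au_val f (spliced h n x)).

(** The bound extends to all z because elements of [hinf] vanish off the ball, so the limits in
    [ulim_comp] exist for every h and x. *)
Lemma au_val_bounded (f : au E) : exists M : R, forall z, rnorm (au_val f z) <= M.
Proof.
have [M fM] := hinf_bounded (au_val f); exists `|M| => z.
have [Bz|nBz] := pselect (uball z); first exact: le_trans (fM _ Bz) (ler_norm _).
by rewrite hinf_out // rnorm0.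
Qed.

Lemma ulim_comp_cvg f h x :
  ucvg U (fun n => au_val f (spliced h n x)) (ulim_comp f h x).
Proof. by have [M fM] := au_val_bounded f; exact: ucvg_bounded (fun n => fM _). Qed.

Lemma ulim_comp_bounded f : exists M : R, forall h x, rnorm (ulim_comp f h x) <= M.
Proof.
by have [M fM] := au_val_bounded f; exists M => h x; apply: ulim_le => n; exact: fM.
Qed.

Lemma uball_shift (V : normedModType R[i]) (x y : V) :
  rnorm (y - x) < 1 - rnorm x -> uball y.
Proof.
move=> xy; apply/uball_rnorm; rewrite -(subrK x y).
by apply: le_lt_trans (rnormD _ _) _; rewrite -ltrBrDr.
Qed.

Lemma ulim_comp_holomorphic f h : uball h -> holomorphic (ulim_comp f h).
Proof.
move=> h1 x x1; have [M fM] := au_val_bounded f.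
apply: (@ulim_differentiable _ _ _ _ (fun n y => au_val f (spliced h n y)) M _ (1 - rnorm x)).
- by rewrite subr_gt0; exact/uball_rnorm.
- move=> n y /uball_shift y1.
  apply: (@differentiable_comp _ _ _ _ (spliced h n) (au_val f)).
    apply: splice_differentiable; first exact: hinf_holomorphic.
    apply: scale_differentiable.
      exact: (@linear_bounded_differentiable _ _ _ _ K).
    apply: cons1_differentiable; exact: hinf_holomorphic.
  by apply: hinf_holomorphic; exact: spliced_ball.
- by move=> n y _.
Qed.

Lemma ulim_comp_analytic f x : uball x -> holomorphic (fun h => ulim_comp f h x).
Proof.
move=> x1 h h1; have [M fM] := au_val_bounded f.
apply: (@ulim_differentiable _ _ _ _ (fun n k => au_val f (spliced k n x)) M _ (1 - rnorm h)).
- by rewrite subr_gt0; exact/uball_rnorm.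
- move=> n k /uball_shift k1.
  apply: (@differentiable_comp _ _ _ _ (fun k => spliced k n x) (au_val f)).
    apply: splice_differentiable; first exact: differentiable_cst.
    apply: scale_differentiable; first exact: differentiable_cst.
    apply: cons1_differentiable.
    apply: (@linear_bounded_differentiable _ _ _ _ 1) => // k'.
    by rewrite mul1r -lecR !rnormE; exact: hinf_norm_ge.
  by apply: hinf_holomorphic; exact: spliced_ball.
- by move=> n y _.
Qed.

(* [insubd] only matters outside of the unit ball, where [fiber_map h] is irrelevant. *)
Definition fiber_map (h : HEE) (f : au E) : HE := insubd (0 : HE) (on_ball (ulim_comp f h)).

Lemma fiber_mapE h f x : uball h -> uball x -> fiber_map h f x = ulim_comp f h x.
Proof.
move=> h1 x1; have [M fM] := ulim_comp_bounded f.
rewrite /fiber_map; have := @insubdK _ _ HE 0 (on_ball (ulim_comp f h)).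
rewrite /= => ->; first exact: on_ball_in.
by apply: (@hinf_on_ball _ _ _ _ M) => //; exact: ulim_comp_holomorphic.
Qed.

Lemma fiber_map_fiber h : uball h -> fiber g (fiber_map h).
Proof.
move=> h1; split; last first.
  move=> x x1; apply/funext => j; rewrite /xi fiber_mapE //; apply: ulimE.
  have zj n : au_val (ell2_coord_au R j) (spliced h n x) =
      if block_index n j is Some k then (l x *: cons1 (h x) : E) k else g x j.
    rewrite -spliceE; exact: (on_ball_in _ (spliced_ball n h1 x1)).
  apply: (@ucvg_near _ _ _ (fun=> g x j)) (ucvg_cst _); apply: oU.
  (* Coordinate j lies in at most one block, and past the number of that block it keeps the value
     [g x j]; hence the successor. *)
  pose N := if pickle_inv j is Some p then (p : nat * nat).1.+1 else 0%N.
  exists N => // n Nn; apply: esym; apply: etrans (zj n) _.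
  move: Nn; rewrite /block_index /=; rewrite /N; case: (pickle_inv j) => [[m k]|] //= mn.
  by rewrite ltn_eqF.
split.
- move=> a f f'; apply: hinfP => x x1.
  rewrite hinf_linE !fiber_mapE //; apply: ulimE.
  exact: (ucvgD (ucvgZ a (ulim_comp_cvg f h x)) (ulim_comp_cvg f' h x)).
- move=> f f'; apply: hinfP => x x1.
  rewrite hinf_mulE !fiber_mapE //; apply: ulimE.
  have [M fM] := au_val_bounded f.
  exact: (ucvgM (fun n => fM _) (ulim_comp_cvg f h x) (ulim_comp_cvg f' h x)).
- exists 1; apply/eqP => /(congr1 (fun F : HE => F 0)).
  have x1 : uball (0 : E) by exact: uball0.
  rewrite fiber_mapE // -[RHS]/(0 : C) => e.
  have : ulim_comp 1 h 0 = 1.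
    apply: ulimE; apply: ucvg_ext (ucvg_cst 1) => n.
    by rewrite /= on_ball_in //; exact: spliced_ball.
  by rewrite e => /esym/eqP; rewrite oner_eq0.
Qed.

Lemma fiber_map_analytic : analytic fiber_map.
Proof.
move=> f x x1 h h1; apply: near_differentiable (ulim_comp_analytic f x1 h1).
by apply: filterS (uball_nbhs h1) => k k1; rewrite fiber_mapE.
Qed.

(** The column forms recover each coordinate of [h x] wherever [l x] is nonzero. As [w] lies outside
    the kernel of [l], such points are dense, and continuity gives the rest. *)
Lemma fiber_map_inj (w : E) : l w != 0 -> set_inj uball fiber_map.
Proof.
move=> lw h h' /set_mem h1 /set_mem h1' e.
have off x : uball x -> l x != 0 -> h x = h' x.
  move=> x1 lx; apply: ell2_ext => j.
  have [F FE] : exists F : au E, forall z, uball z -> au_val F z = column_form U j z.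
    apply: au_on_ball; last exact: column_form_unif.
    by move=> z _; exact: column_form_differentiable.
  have E0 : ulim_comp F h x = ulim_comp F h' x.
    by rewrite -(fiber_mapE F h1 x1) -(fiber_mapE F h1' x1) e.
  have := ucvgD (ulim_comp_cvg F h x) (ucvgZ (-1) (ulim_comp_cvg F h' x)).
  rewrite E0 mulN1r subrr => cv0.
  (* The sequence is constant in n, so its limit is explicit, while [E0] forces the limit 0. *)
  have cv : ucvg U (fun n => au_val F (spliced h n x) + -1 * au_val F (spliced h' n x))
     (l x ^+ 2 * (h x j - h' x j)).
    apply: ucvg_ext (ucvg_cst _) => n; rewrite mulN1r !FE; try exact: spliced_ball.
    have tl k i : (l x *: cons1 k : E) i = l x * cons1 k i by [].
    have w0 : (l x *: cons1 (h x) : E) 0%N = (l x *: cons1 (h' x) : E) 0%N.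
      by rewrite !tl !cons10.
    rewrite /spliced (column_form_splice oU _ _ _ w0) !tl cons10 !cons1S; ring.
  have E1 : (l x : R[i]) ^+ 2 * (h x j - h' x j) = 0 :> R[i].
    exact: ucvg_unique cv (cv0 UU UU).
  by apply: subr0_eq; apply: (mulfI (expf_neq0 2 lx)); rewrite E1 mulr0.
apply: hinfP => x x1; have [lx|lx] := eqVneq (l x) 0; last exact: off.
apply/eqP; rewrite -subr_eq0; apply/eqP/rnorm0_eq0/eqP.
rewrite eq_le rnorm_ge0 andbT; apply/ler_addgt0Pr => eps eps0; rewrite add0r.
have dd : differentiable (fun y => h y - h' y) x.
  by apply: differentiableB; exact: hinf_holomorphic.
have [L L0 [d d0 Ld]] := differentiable_lipschitz dd.
have x1' : 0 < 1 - rnorm x by rewrite subr_gt0; exact/uball_rnorm.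
have w0 : 0 < rnorm w + 1 by rewrite ltr_wpDl ?rnorm_ge0.
(* A step of length at most m towards [w] stays in the ball and in the range of the Lipschitz bound,
   and changes [h - h'] by at most eps. *)
pose m := Num.min (Num.min d (eps / L)) ((1 - rnorm x) / 2).
have m0 : 0 < m by rewrite !lt_min d0 !divr_gt0.
pose t := m / (rnorm w + 1); have t0 : 0 < t by rewrite divr_gt0.
have tw : rnorm (t%:C *: w) <= m.
  rewrite rnorm_realZ ger0_norm ?(ltW t0) // /t mulrAC ler_pdivrMr //.
  by rewrite ler_wpM2l ?(ltW m0) // lerDl.
move: (tw); rewrite !le_min => /andP[/andP[twd twe] tw2].
have xw1 : uball (x + t%:C *: w).
  apply: (@uball_shift _ x); rewrite addrAC subrr add0r; apply: le_lt_trans tw2 _.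
  by rewrite ltr_pdivrMr // ltr_pMr // ltrDl.
have lxw : l (x + t%:C *: w) != 0.
  rewrite addrC l_lin lx addr0 mulf_neq0 //.
  by apply/eqP => /complexI/eqP; rewrite gt_eqF.
have := Ld _ twd; rewrite (off _ xw1 lxw) subrr sub0r rnormN => /le_trans; apply.
by rewrite mulrC -ler_pdivlMr.
Qed.

End fiber_embedding.

Theorem theorem2p13 (R : realType) (g : hinf (ell2 R) (ell2 R))
    (g_norm1 : `|g| = 1)
    (g_ball : forall x, uball x -> uball (g x))
    (g_osc : `|g 0| + `|g - hcst (ell2 R) (g 0)| <= 1)
    (g_proj : exists P : {linear ell2 R -> ell2 R},
      [/\ (opnorm P <= 1)%E,
          exists2 v : ell2 R, v != 0 & P v = 0 &
          forall x, uball x -> g x = g (P x)]) :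
  exists Psi : hinf (ell2 R) (ell2 R) -> au (ell2 R) -> hinf (ell2 R) R[i]^o,
    [/\ forall h, uball h -> fiber g (Psi h),
        set_inj uball Psi &
        analytic Psi].
Proof.
have [U [UU oU]] := ultraFilterLemma (F := \oo) _.
have [P [P1 [v v0 Pv] gP]] := g_proj.
have [l [l_lin [K lK] [w lw] gap]] := kernel_gap oU g_ball g_osc P1 v0 Pv gP.
exists (fiber_map U g l); split.
- exact: fiber_map_fiber.
- exact: fiber_map_inj lw.
- exact: fiber_map_analytic.
Qed.
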